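(* Let $f$ be a prenormalized parabolic germ of formal type $(k=1,\lambda=0)$, i.e. $f(z)=z+z^2+z^3+o(z^3)$, analytic at $0\in\mathbb{C}$. Let $g\in\mathbb{C}\{z\}$, $g\not\equiv0$, be of multiplicity $k\in\mathbb{N}_0$, $g(z)=\alpha_kz^k+o(z^k)$, $\alpha_k\ne0$; if $k\in\{0,1\}$ write $g(z)=\alpha_0+\alpha_1z+o(z)$ and $h_{\alpha_0,\alpha_1}(z)=-\frac{\alpha_0}z+\alpha_1\mathrm{Log}(z)$. The generalized Abel equation $$H(f(z))-H(z)=g(z)$$ has a globally analytic solution on some neighborhood of $z=0$ if and only if $f$ is of the form $$f(z)=\begin{cases}\varphi^{-1}\Big(h_{\alpha_0,\alpha_1}^{-1}\big(h_{\alpha_0,\alpha_1}(\varphi(z))+g(z)\big)\Big),& k=0,1,\\[2mm] \varphi^{-1}\left(\varphi(z)\cdot\Big(1+\frac{k-1}{\alpha_k}\frac{g(z)}{\varphi(z)^{k-1}}\Big)^{\frac1{k-1}}\right),& k\ge2,\end{cases}$$ for some analytic germ $\varphi(z)\in z+z^2\mathbb{C}\{z\}$. The globally analytic solution is then given by $$H(z)=\begin{cases}h_{\alpha_0,\alpha_1}\circ\varphi(z),& k=0,1,\\ \frac{\alpha_k}{k-1}\varphi(z)^{k-1},& k\ge2,\end{cases}$$ and it is unique up to an arbitrary additive constant.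
   Context: $\mathbb{C}\{z\}$ denotes convergent power series at $0$. The convention for ''globally analytic'': if $\alpha_0\neq0$ or $\alpha_1\ne0$ ($k\in\{0,1\}$), a solution $H$ is called globally analytic on a neighborhood of $0$ if $H(z)=-\frac{\alpha_0}z+\alpha_1\mathrm{Log}(z)+R(z)$ with $R$ analytic on a neighborhood of $0$, i.e. if $R$ is an analytic solution of the modified equation $R(f(z))-R(z)=g(z)+\alpha_0\left(\frac1{f(z)}-\frac1z\right)-\alpha_1\mathrm{Log}\left(\frac{f(z)}z\right)$ (main branch of $\mathrm{Log}$ near $1$); if $k\ge2$, it means that $H$ is analytic on a neighborhood of $0$. In the formula with $h_{\alpha_0,\alpha_1}^{-1}$, $w=h^{-1}_{\alpha_0,\alpha_1}(h_{\alpha_0,\alpha_1}(v)+g(z))$ with $v=\varphi(z)$ denotes the solution with $w/v$ close to $1$ of $-\alpha_0\left(\frac1w-\frac1v\right)+\alpha_1\mathrm{Log}\left(\frac wv\right)=g(z)$. In the formula with the $(k-1)$-th root, the main branch near $1$ is used. *)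

(* Defs.v *)
From Stdlib Require Export Reals.
From Coquelicot Require Export Coquelicot.
Open Scope C_scope.

(* Germs at 0 are represented by total functions C -> C; values away from 0
   never matter. *)

Definition near0 (P : C -> Prop) : Prop := @locally C_UniformSpace (RtoC 0) P.

Definition near0' (P : C -> Prop) : Prop := @locally' C_UniformSpace (RtoC 0) P.

(* Convergence on a full neighbourhood: positive radius of convergence. *)
Definition has_expansion (f : C -> C) (a : nat -> C) : Prop :=
  near0 (fun z => @is_pseries C_AbsRing C_NormedModule a z (f z)).

Definition analytic0 (f : C -> C) : Prop := exists a, has_expansion f a.

(* e(z) = o(z^n) as z -> 0. *)
Definition o_pow (n : nat) (e : C -> C) : Prop :=
  @is_domin C C_AbsRing C_AbsRing C_NormedModule C_NormedModule
    near0 (fun z => z ^ n) e.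

Definition prenormalized (f : C -> C) : Prop :=
  analytic0 f /\ o_pow 3 (fun z => f z - (z + z ^ 2 + z ^ 3)).

(* phi belongs to z + z^2 C{z}. *)
Definition tangent_id (phi : C -> C) : Prop :=
  exists a, a 0%nat = RtoC 0 /\ a 1%nat = RtoC 1 /\ has_expansion phi a.

(* psi is the compositional inverse of phi in the group of germs fixing 0. *)
Definition germ_inverse (phi psi : C -> C) : Prop :=
  analytic0 psi /\ psi 0 = 0 /\
  near0 (fun z => psi (phi z) = z) /\ near0 (fun z => phi (psi z) = z).

(* Principal argument, in (-PI, PI]. *)
Definition Carg (z : C) : R :=
  if Rle_dec 0 (Im z) then acos (Re z / Cmod z) else (- acos (Re z / Cmod z))%R.

Definition Clog (z : C) : C := (ln (Cmod z), Carg z).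

Definition Cexp (z : C) : C :=
  ((exp (Re z) * cos (Im z))%R, (exp (Re z) * sin (Im z))%R).

(* n-th root, main branch. *)
Definition Croot (n : nat) (z : C) : C := Cexp (Clog z / RtoC (INR n)).

Definition h (a0 a1 : C) (z : C) : C := - (a0 / z) + a1 * Clog z.

(* The germ of h_{a0,a1} o phi, for phi tangent to the identity.  The logarithm
   of phi(z) is the branch that continues Log z, namely
   Log z + Log (phi(z) / z) with phi(z) / z near 1; Clog (phi z) itself would
   differ from it by 2 i PI at the points where the segment from z to phi(z)
   crosses the cut of the principal branch. *)
Definition h_comp (a0 a1 : C) (phi : C -> C) (z : C) : C :=
  - (a0 / phi z) + a1 * (Clog z + Clog (phi z / z)).

(* w = h_{a0,a1}^{-1} (h_{a0,a1}(v) + t). *)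
Definition is_h_shift (a0 a1 : C) (v t w : C -> C) : Prop :=
  filterlim (fun z => w z / v z) near0' (@locally C_UniformSpace (RtoC 1)) /\
  near0' (fun z =>
    - a0 * (1 / w z - 1 / v z) + a1 * Clog (w z / v z) = t z).

(* For k <= 1 the function H is ramified at 0: it is represented by its
   determination with the principal logarithm, and the Abel equation is the
   modified equation on its regular part, in which the logarithm of f(z) / z is
   the main branch near 1. *)
Definition globally_analytic_solution
    (f g : C -> C) (k : nat) (alpha : nat -> C) (H : C -> C) : Prop :=
  match k with
  | 0%nat | 1%nat =>
      let a0 := alpha 0%nat in let a1 := alpha 1%nat in
      exists R : C -> C,
        analytic0 R /\
        near0' (fun z => H z = h a0 a1 z + R z) /\
        near0' (fun z =>
          R (f z) - R z
          = g z + a0 * (1 / f z - 1 / z) - a1 * Clog (f z / z))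
  | _ =>
      analytic0 H /\ near0 (fun z => H (f z) - H z = g z)
  end.

(* Germ equality of solutions; for k <= 1 they are not defined at 0. *)
Definition same_solution (k : nat) (H1 H2 : C -> C) : Prop :=
  match k with
  | 0%nat | 1%nat => near0' (fun z => H1 z = H2 z)
  | _ => near0 (fun z => H1 z = H2 z)
  end.

(* The germ f is obtained from phi by the closed formula.  The equality at
   z = 0, where the formulas are understood by continuity, is f(0) = 0. *)
Definition has_form
    (f g : C -> C) (k : nat) (alpha : nat -> C) (phi : C -> C) : Prop :=
  exists psi : C -> C, germ_inverse phi psi /\
  match k with
  | 0%nat | 1%nat =>
      exists w : C -> C,
        is_h_shift (alpha 0%nat) (alpha 1%nat) phi g w /\
        near0' (fun z => f z = psi (w z))
  | _ =>
      near0' (fun z =>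
        f z = psi (phi z *
          Croot (k - 1)
            (1 + RtoC (INR (k - 1)) / alpha k * (g z / phi z ^ (k - 1)))))
  end.

Definition solution_of
    (k : nat) (alpha : nat -> C) (phi : C -> C) : C -> C :=
  match k with
  | 0%nat | 1%nat => h_comp (alpha 0%nat) (alpha 1%nat) phi
  | _ => fun z => alpha k / RtoC (INR (k - 1)) * phi z ^ (k - 1)
  end.

(* Main.v *)
(* A solution H is brought to normal form by a change of variable phi tangent to the
   identity: h o phi = H + const if k <= 1, and alpha_k / (k-1) phi^(k-1) = H - H(0) if
   k >= 2, where comparing the leading terms of H o f - H and g gives H - H(0) the order
   k - 1 and the right leading coefficient.  The equation H(f) - H = g then determines
   phi(f) in terms of phi and g, the branch being fixed by phi(f) / phi -> 1, and f is
   recovered by phi^(-1); every step can be reversed.  For uniqueness, a non-constant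
   analytic D = D(0) + d z^m + ... satisfies D(f) - D = m d z^(m+1) + ..., which is not 0.

   All germs involved (inverses, logarithms, roots, solutions of the equation for phi) are
   shown to be C^1 in the complex sense; Cauchy's formula on a circle then expands them in
   power series. *)

Require Import Defs.
From Stdlib Require Import Lra Lia Psatz Classical ClassicalEpsilon.

(** * Limits of complex-valued functions *)

(** Power series behave badly under inversion, implicit equations and choice of branches, while
    slopes compose, invert and pass to limits directly. So coefficients are used only where orders
    at 0 matter, and everything else is done with slopes.

    Branches are controlled by taking logarithms and roots only of quantities that tend to 1, such
    as [phi z / z], [f z / z] and [phi (f z) / phi z]. There the principal logarithm is additive,
    and [Clog z] never has to be compared with [Clog (f z)].

    For k <= 1 the unknown phi is determined by the germ h o phi - h, which is regular at 0 and must
    equal the regular part R up to a constant. If k = 0, the pole lets phi absorb any constant, so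
    the equality can be made exact; this leads to an implicit equation, solved by contraction. If k
    = 1, then alpha_0 = 0 and the remaining term a1 Log (phi z / z) vanishes at 0, so R(0) is left
    over, and phi is an explicit exponential. *)

Notation nbhd z := (@locally C_UniformSpace z).

(** One epsilon form for all the filters in use: [nbhd z], [near0'], neighborhoods in the line or
    the plane, and [eventually]. The limit rules are then proved once. *)
Definition clim {T : Type} (F : (T -> Prop) -> Prop) (u : T -> C) (l : C) : Prop :=
  forall eps : R, 0 < eps -> F (fun x => Cmod (u x - l) < eps).

Definition ccont (f : C -> C) (z : C) : Prop := clim (nbhd z) f (f z).

Lemma nbhd_iff (z : C) (P : C -> Prop) :
  nbhd z P <-> exists d : R, 0 < d /\ forall w, Cmod (w - z) < d -> P w.
Proof.
  split.
  - intros H. apply locally_C in H. destruct H as [d Hd].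
    exists d. split; [apply cond_pos|]. intros w Hw. apply Hd. exact Hw.
  - intros [d [Hd H]]. apply locally_C. exists (mkposreal d Hd).
    intros w Hw. apply H. exact Hw.
Qed.

Lemma Cminus_0_r (w : C) : w - 0 = w.
Proof. ring. Qed.

Lemma punctured_nbhd_iff (P : C -> Prop) :
  near0' P <-> exists d : R, 0 < d /\ forall w : C, w <> 0 -> Cmod w < d -> P w.
Proof.
  unfold near0', locally', within. rewrite nbhd_iff.
  split; intros [d [Hd H]]; exists d; (split; [exact Hd|]); intros w H1 H2.
  - apply H; [now rewrite Cminus_0_r|exact H1].
  - apply H; [exact H2|now rewrite Cminus_0_r in H1].
Qed.

Lemma near0_punctured (P : C -> Prop) : near0 P -> near0' P.
Proof.
  unfold near0, near0', locally', within. apply filter_imp. auto.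
Qed.

Lemma near0_center (P : C -> Prop) : near0' P -> P 0 -> near0 P.
Proof.
  intros H H0. apply (filter_imp (fun z : C => z <> 0 -> P z)); [|exact H].
  intros z Hz. destruct (Ceq_dec z 0) as [->|Hn]; auto.
Qed.

Lemma punctured_neq0 : near0' (fun z => z <> 0).
Proof. apply punctured_nbhd_iff. exists 1%R. split; [lra|auto]. Qed.

#[global] Instance near0_filter : ProperFilter near0.
Proof. exact (@locally_filter C_UniformSpace (RtoC 0)). Qed.

#[global] Instance punctured_filter : ProperFilter near0'.
Proof.
  constructor.
  - intros P HP. apply punctured_nbhd_iff in HP. destruct HP as [d [Hd H]].
    exists (RtoC (d / 2)). apply H.
    + intros E. apply RtoC_inj in E. lra.
    + rewrite Cmod_R, Rabs_right; lra.
  - unfold near0'. apply within_filter, filter_filter.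
Qed.

Lemma nbhd_center (z : C) (P : C -> Prop) : nbhd z P -> P z.
Proof. apply locally_singleton. Qed.

Lemma Cmod_minus_sym (a b : C) : Cmod (a - b) = Cmod (b - a).
Proof. rewrite <- Cmod_opp. f_equal. ring. Qed.

Lemma Cmod_minus_triangle (a b : C) : Cmod a - Cmod b <= Cmod (a - b).
Proof.
  generalize (Cmod_triangle (a - b) b). replace (a - b + b) with a by ring. lra.
Qed.

Section Limits.
Context {T : Type} {F : (T -> Prop) -> Prop} {FF : Filter F}.

Lemma clim_filterlim (u : T -> C) (l : C) :
  clim F u l <-> filterlim u F (nbhd l).
Proof.
  split.
  - intros H P HP. apply nbhd_iff in HP. destruct HP as [d [Hd HP]].
    unfold filtermap. generalize (H d Hd). apply filter_imp. auto.
  - intros H eps Heps. apply (H (fun w => Cmod (w - l) < eps)).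
    apply nbhd_iff. exists eps. auto.
Qed.

Lemma clim_nbhd (u : T -> C) (l : C) (P : C -> Prop) :
  clim F u l -> nbhd l P -> F (fun x => P (u x)).
Proof. intros H HP. apply clim_filterlim in H. exact (H P HP). Qed.

Lemma clim_ext (u v : T -> C) (l : C) :
  F (fun x => u x = v x) -> clim F u l -> clim F v l.
Proof.
  intros E H eps Heps. generalize (filter_and _ _ E (H eps Heps)).
  apply filter_imp. intros x [<- Hx]. exact Hx.
Qed.

Lemma clim_eq (u : T -> C) (a b : C) : clim F u a -> a = b -> clim F u b.
Proof. now intros H <-. Qed.

Lemma clim_const (c : C) : clim F (fun _ => c) c.
Proof.
  intros eps Heps. apply filter_forall. intros x.
  replace (c - c) with (RtoC 0) by ring. now rewrite Cmod_0.
Qed.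

Lemma clim_plus (u v : T -> C) (a b : C) :
  clim F u a -> clim F v b -> clim F (fun x => u x + v x) (a + b).
Proof.
  intros Hu Hv eps Heps.
  assert (He : 0 < eps / 2) by lra.
  generalize (filter_and _ _ (Hu _ He) (Hv _ He)). apply filter_imp.
  intros x [H1 H2]. replace (u x + v x - (a + b)) with ((u x - a) + (v x - b)) by ring.
  eapply Rle_lt_trans; [apply Cmod_triangle|]. lra.
Qed.

Lemma clim_opp (u : T -> C) (a : C) :
  clim F u a -> clim F (fun x => - u x) (- a).
Proof.
  intros Hu eps Heps. generalize (Hu eps Heps). apply filter_imp.
  intros x H. replace (- u x - - a) with (- (u x - a)) by ring. now rewrite Cmod_opp.
Qed.

Lemma clim_minus (u v : T -> C) (a b : C) :
  clim F u a -> clim F v b -> clim F (fun x => u x - v x) (a - b).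
Proof. intros Hu Hv. apply clim_plus; auto. now apply clim_opp. Qed.

Lemma clim_mult (u v : T -> C) (a b : C) :
  clim F u a -> clim F v b -> clim F (fun x => u x * v x) (a * b).
Proof.
  intros Hu Hv eps Heps.
  generalize (Cmod_ge_0 a) (Cmod_ge_0 b); intros Ha Hb.
  set (M := (1 + Cmod a + Cmod b)%R).
  assert (HM : 0 < M) by (unfold M; lra).
  (* Capping [e] at 1 bounds the product of the two errors by a single [e], so that the total error
     is at most [e * M]. *)
  set (e := Rmin 1 (eps / M / 2)).
  assert (He' : 0 < eps / M / 2).
  { apply Rdiv_lt_0_compat; [apply Rdiv_lt_0_compat|]; lra. }
  assert (He : 0 < e) by (apply Rmin_glb_lt; lra).
  generalize (filter_and _ _ (Hu _ He) (Hv _ He)). apply filter_imp.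
  intros x [H1 H2].
  replace (u x * v x - a * b) with ((u x - a) * (v x - b) + (a * (v x - b) + b * (u x - a))) by ring.
  eapply Rle_lt_trans; [apply Cmod_triangle|].
  eapply Rle_lt_trans; [apply Rplus_le_compat_l, Cmod_triangle|].
  rewrite !Cmod_mult.
  assert (E1 : e <= 1) by apply Rmin_l.
  assert (E2 : e <= eps / M / 2) by apply Rmin_r.
  generalize (Cmod_ge_0 (u x - a)) (Cmod_ge_0 (v x - b)); intros P1 P2.
  apply Rle_lt_trans with (e * M)%R.
  - unfold M. nra.
  - apply Rle_lt_trans with (eps / M / 2 * M)%R; [nra|].
    replace (eps / M / 2 * M)%R with (eps / 2)%R by (field; lra). lra.
Qed.

Lemma clim_neq0 (u : T -> C) (a : C) :
  a <> 0 -> clim F u a -> F (fun x => u x <> 0).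
Proof.
  intros Ha Hu. apply Cmod_gt_0 in Ha. generalize (Hu _ Ha). apply filter_imp.
  intros x Hx E. rewrite E in Hx. replace (0 - a) with (- a) in Hx by ring.
  rewrite Cmod_opp in Hx. lra.
Qed.

Lemma clim_inv (u : T -> C) (a : C) :
  a <> 0 -> clim F u a -> clim F (fun x => / u x) (/ a).
Proof.
  intros Ha Hu eps Heps. assert (Ha' := proj1 (Cmod_gt_0 a) Ha).
  set (e := Rmin (Cmod a / 2) (eps * (Cmod a * (Cmod a / 2)))).
  assert (He' : 0 < eps * (Cmod a * (Cmod a / 2))) by (repeat apply Rmult_lt_0_compat; lra).
  assert (He : 0 < e) by (apply Rmin_glb_lt; lra).
  generalize (filter_and _ _ (Hu _ He) (clim_neq0 u a Ha Hu)). apply filter_imp.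
  intros x [H1 H2].
  replace (/ u x - / a) with ((a - u x) / (a * u x)) by (field; auto).
  rewrite Cmod_div by (apply Cmult_neq_0; auto).
  rewrite Cmod_mult, Cmod_minus_sym.
  assert (E1 : e <= Cmod a / 2) by apply Rmin_l.
  assert (E2 : e <= eps * (Cmod a * (Cmod a / 2))) by apply Rmin_r.
  assert (Hux : Cmod a / 2 < Cmod (u x)).
  { generalize (Cmod_minus_triangle a (u x)). rewrite Cmod_minus_sym. lra. }
  assert (Hp : 0 < Cmod a * Cmod (u x)) by (apply Rmult_lt_0_compat; lra).
  apply Rmult_lt_reg_r with (Cmod a * Cmod (u x))%R; auto.
  unfold Rdiv. rewrite Rmult_assoc, Rinv_l, Rmult_1_r by lra.
  eapply Rlt_le_trans; [exact H1|]. eapply Rle_trans; [exact E2|].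
  apply Rmult_le_compat_l; [lra|]. apply Rmult_le_compat_l; lra.
Qed.

Lemma clim_div (u v : T -> C) (a b : C) :
  b <> 0 -> clim F u a -> clim F v b -> clim F (fun x => u x / v x) (a / b).
Proof. intros Hb Hu Hv. apply clim_mult; auto. now apply clim_inv. Qed.

Lemma clim_pow (u : T -> C) (a : C) (n : nat) :
  clim F u a -> clim F (fun x => u x ^ n) (a ^ n).
Proof.
  intros Hu. induction n as [|n IH].
  - apply (clim_const 1).
  - rewrite Cpow_S. apply clim_ext with (fun x => u x * u x ^ n).
    + apply filter_forall. intros x. now rewrite Cpow_S.
    + now apply clim_mult.
Qed.

Lemma clim_comp (f : C -> C) (u : T -> C) (a : C) :
  clim F u a -> ccont f a -> clim F (fun x => f (u x)) (f a).
Proof.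
  intros Hu Hf eps Heps. apply (clim_nbhd u a (fun w => Cmod (f w - f a) < eps)); auto.
Qed.

Lemma clim_Re (u : T -> C) (l : C) :
  clim F u l -> filterlim (fun x => Re (u x)) F (locally (Re l)).
Proof.
  intros H P [d Hd]. unfold filtermap. generalize (H d (cond_pos d)). apply filter_imp.
  intros x Hx. apply Hd. change (Rabs (Re (u x) - Re l) < d).
  eapply Rle_lt_trans; [|exact Hx]. apply (re_le_Cmod (u x - l)).
Qed.

Lemma im_le_Cmod (c : C) : Rabs (Im c) <= Cmod c.
Proof. eapply Rle_trans; [apply Rmax_r|apply Rmax_Cmod]. Qed.

Lemma clim_Im (u : T -> C) (l : C) :
  clim F u l -> filterlim (fun x => Im (u x)) F (locally (Im l)).
Proof.
  intros H P [d Hd]. unfold filtermap. generalize (H d (cond_pos d)). apply filter_imp.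
  intros x Hx. apply Hd. change (Rabs (Im (u x) - Im l) < d).
  eapply Rle_lt_trans; [|exact Hx]. apply (im_le_Cmod (u x - l)).
Qed.

Lemma Cmod_le_components (c : C) : Cmod c <= Rabs (Re c) + Rabs (Im c).
Proof.
  replace c with (RtoC (Re c) + Ci * RtoC (Im c)) at 1.
  - eapply Rle_trans; [apply Cmod_triangle|].
    rewrite Cmod_mult, !Cmod_R, Cmod_Ci. lra.
  - destruct c as [x y]. unfold RtoC, Ci, Cplus, Cmult; simpl. f_equal; ring.
Qed.

Lemma clim_pair (a b : T -> R) (x y : R) :
  filterlim a F (locally x) -> filterlim b F (locally y) ->
  clim F (fun t => (a t, b t) : C) (x, y).
Proof.
  intros Ha Hb eps Heps. assert (He : 0 < eps / 2) by lra.
  assert (H1 := Ha _ (locally_ball x (mkposreal _ He))).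
  assert (H2 := Hb _ (locally_ball y (mkposreal _ He))).
  change (F (fun t => Rabs (a t - x) < eps / 2)) in H1.
  change (F (fun t => Rabs (b t - y) < eps / 2)) in H2.
  generalize (filter_and _ _ H1 H2). apply filter_imp. intros t [K1 K2].
  eapply Rle_lt_trans; [apply Cmod_le_components|]. simpl.
  unfold Rminus in *. lra.
Qed.

Lemma clim_unique (PF : ProperFilter F) (u : T -> C) (a b : C) :
  clim F u a -> clim F u b -> a = b.
Proof.
  intros Ha Hb. destruct (Ceq_dec a b) as [|Hn]; auto. exfalso.
  assert (Hd : 0 < Cmod (a - b) / 2).
  { apply Cminus_eq_contra, Cmod_gt_0 in Hn. lra. }
  destruct (filter_ex _ (filter_and _ _ (Ha _ Hd) (Hb _ Hd))) as [x [H1 H2]].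
  generalize (Cmod_triangle (a - u x) (u x - b)).
  replace (a - u x + (u x - b)) with (a - b) by ring.
  rewrite (Cmod_minus_sym a (u x)). intros H3. lra.
Qed.

Lemma clim_squeeze0 (u : T -> C) (v : T -> C) :
  F (fun x => Cmod (u x) <= Cmod (v x)) -> clim F v 0 -> clim F u 0.
Proof.
  intros H Hv eps Heps. generalize (filter_and _ _ H (Hv eps Heps)). apply filter_imp.
  intros x [H1 H2]. rewrite Cminus_0_r in *. lra.
Qed.

End Limits.

Lemma clim_sub {T} (F G : (T -> Prop) -> Prop) (u : T -> C) l :
  (forall P, F P -> G P) -> clim F u l -> clim G u l.
Proof. intros HFG H eps Heps. apply HFG. auto. Qed.

Lemma clim_id (z : C) : clim (nbhd z) (fun w => w) z.
Proof. intros eps Heps. apply nbhd_iff. exists eps. auto. Qed.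

Lemma clim_punctured_id : clim near0' (fun w => w) 0.
Proof. apply (clim_sub near0); [exact near0_punctured|apply clim_id]. Qed.

(** * Complex differentiability *)

(* Caratheodory's form of complex differentiability. *)
Definition cderiv (f : C -> C) (z l : C) : Prop :=
  exists q : C -> C,
    (forall w, f w = f z + q w * (w - z)) /\ q z = l /\ ccont q z.

Definition rderiv (p : R -> C) (t : R) (l : C) : Prop :=
  exists q : R -> C,
    (forall s, p s = p t + q s * RtoC (s - t)) /\ q t = l /\ clim (locally t) q l.

(** Continuity of the derivative is built in because Cauchy's formula is obtained below by
    differentiating under the integral sign; this takes the place of Goursat's lemma. *)
Definition hol (z : C) (f : C -> C) : Prop :=
  exists f' : C -> C, nbhd z (fun w => cderiv f w (f' w) /\ ccont f' w).

Lemma ccont_intro (f : C -> C) (z l : C) : clim (nbhd z) f l -> f z = l -> ccont f z.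
Proof. intros H <-. exact H. Qed.

Lemma nbhd_nbhd (z : C) (P : C -> Prop) : nbhd z P -> nbhd z (fun w => nbhd w P).
Proof. apply locally_locally. Qed.

Lemma ccont_ext (f g : C -> C) (z : C) :
  nbhd z (fun w => f w = g w) -> ccont f z -> ccont g z.
Proof.
  intros E H. unfold ccont. rewrite <- (nbhd_center _ _ E). now apply clim_ext with f.
Qed.

Lemma cderiv_cont (f : C -> C) (z l : C) : cderiv f z l -> ccont f z.
Proof.
  intros [q [E [_ Hq]]]. unfold ccont.
  apply clim_ext with (fun w => f z + q w * (w - z)).
  { apply filter_forall. intros w. now rewrite <- E. }
  apply clim_eq with (f z + q z * (z - z)); [|ring].
  apply clim_plus; [apply clim_const|]. apply clim_mult; [exact Hq|].
  apply clim_minus; [apply clim_id|apply clim_const].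
Qed.

(** The identity in [cderiv] is global, so the slope is rebuilt as the true difference quotient; the
    given [q] has to agree with it only near [z]. *)
Lemma cderiv_of_quotient (f q : C -> C) (z l : C) :
  nbhd z (fun w => w <> z -> f w = f z + q w * (w - z)) ->
  q z = l -> ccont q z -> cderiv f z l.
Proof.
  intros E Hl Hq.
  exists (fun w => if Ceq_dec w z then l else (f w - f z) / (w - z)).
  split; [|split].
  - intros w. destruct (Ceq_dec w z) as [->|Hn]; [ring|].
    field. now apply Cminus_eq_contra.
  - destruct (Ceq_dec z z); [reflexivity|easy].
  - apply ccont_ext with q; auto. generalize E. apply filter_imp. intros w Hw.
    destruct (Ceq_dec w z) as [->|Hn]; auto. rewrite (Hw Hn).
    field. now apply Cminus_eq_contra.
Qed.

Lemma cderiv_ext (f g : C -> C) (z l : C) :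
  nbhd z (fun w => f w = g w) -> cderiv f z l -> cderiv g z l.
Proof.
  intros E [q [Eq [Hl Hq]]]. apply cderiv_of_quotient with q; auto.
  generalize E. apply filter_imp. intros w Hw _.
  rewrite <- Hw, <- (nbhd_center _ _ E). apply Eq.
Qed.

Lemma cderiv_const (c z : C) : cderiv (fun _ => c) z 0.
Proof.
  exists (fun _ => 0). split; [intros; ring|]. split; [reflexivity|]. apply clim_const.
Qed.

Lemma cderiv_id (z : C) : cderiv (fun w => w) z 1.
Proof.
  exists (fun _ => 1). split; [intros; ring|]. split; [reflexivity|]. apply clim_const.
Qed.

Lemma cderiv_plus (f g : C -> C) (z a b : C) :
  cderiv f z a -> cderiv g z b -> cderiv (fun w => f w + g w) z (a + b).
Proof.
  intros [p [E1 [H1 K1]]] [q [E2 [H2 K2]]]. exists (fun w => p w + q w).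
  split; [|split].
  - intros w. rewrite (E1 w), (E2 w). ring.
  - now rewrite H1, H2.
  - now apply clim_plus.
Qed.

Lemma cderiv_mult (f g : C -> C) (z a b : C) :
  cderiv f z a -> cderiv g z b -> cderiv (fun w => f w * g w) z (a * g z + f z * b).
Proof.
  intros Hf Hg. assert (Hc := cderiv_cont _ _ _ Hg).
  destruct Hf as [p [E1 [H1 K1]]], Hg as [q [E2 [H2 K2]]].
  exists (fun w => p w * g w + f z * q w). split; [|split].
  - intros w. rewrite (E1 w), (E2 w). ring.
  - now rewrite H1, H2.
  - apply clim_plus; apply clim_mult; auto. apply clim_const.
Qed.

Lemma cderiv_comp (f g : C -> C) (z a b : C) :
  cderiv f (g z) a -> cderiv g z b -> cderiv (fun w => f (g w)) z (a * b).
Proof.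
  intros Hf Hg. assert (Hc := cderiv_cont _ _ _ Hg).
  destruct Hf as [p [E1 [H1 K1]]], Hg as [q [E2 [H2 K2]]].
  exists (fun w => p (g w) * q w). split; [|split].
  - intros w. rewrite (E1 (g w)). rewrite (E2 w) at 2. ring.
  - now rewrite H1, H2.
  - apply clim_mult; auto. now apply clim_comp.
Qed.

Lemma cderiv_inv (z : C) : z <> 0 -> cderiv Cinv z (- / (z * z)).
Proof.
  intros Hz. apply cderiv_of_quotient with (fun w => - / (w * z)).
  - generalize (clim_neq0 _ _ Hz (clim_id z)). apply filter_imp. intros w Hw _.
    field. auto.
  - reflexivity.
  - apply clim_opp, clim_inv.
    + now apply Cmult_neq_0.
    + apply clim_mult; [apply clim_id|apply clim_const].
Qed.

Lemma cderiv_rderiv (f : C -> C) (p : R -> C) (t : R) (a b : C) :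
  cderiv f (p t) a -> rderiv p t b -> rderiv (fun s => f (p s)) t (a * b).
Proof.
  intros [u [E1 [H1 K1]]] [q [E2 [H2 K2]]]. exists (fun s => u (p s) * q s).
  split; [|split].
  - intros s. rewrite (E1 (p s)). replace (p s - p t) with (q s * RtoC (s - t)) by (rewrite (E2 s); ring). ring.
  - now rewrite H1, H2.
  - rewrite <- H1. apply clim_mult; auto. apply clim_comp; auto.
    apply clim_eq with (p t + b * RtoC (t - t)); [|rewrite Rminus_diag; ring].
    apply clim_ext with (fun s => p t + q s * RtoC (s - t)).
    { apply filter_forall. intros s. now rewrite <- E2. }
    apply clim_plus; [apply clim_const|]. apply clim_mult; auto.
    apply (clim_pair (fun s => (s - t)%R) (fun _ => 0%R)).
    + apply (continuous_minus (fun s : R => s) (fun _ => t)).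
      * apply continuous_id.
      * apply continuous_const.
    + apply filterlim_const.
Qed.

Lemma is_derive_quotient (u q : R -> R) (t l : R) :
  (forall s, u s = u t + q s * (s - t))%R -> filterlim q (locally t) (locally l) ->
  is_derive u t l.
Proof.
  intros E H. apply is_derive_Reals. intros eps Heps.
  destruct (H _ (locally_ball l (mkposreal eps Heps))) as [d Hd].
  exists d. intros h Hh Hhd. rewrite (E (t + h)%R).
  replace ((u t + q (t + h) * (t + h - t) - u t) / h)%R with (q (t + h))%R by (field; auto).
  apply (Hd (t + h)%R). change (Rabs (t + h - t) < d).
  now replace (t + h - t)%R with h by ring.
Qed.

Lemma is_derive_continuity_pt (u : R -> R) (t l : R) :
  is_derive u t l -> continuity_pt u t.
Proof.
  intros H. apply derivable_continuous_pt. exists l. now apply is_derive_Reals.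
Qed.

Lemma rderiv_Re (p : R -> C) (t : R) (l : C) :
  rderiv p t l -> is_derive (fun s => Re (p s)) t (Re l).
Proof.
  intros [q [E [_ H]]]. apply is_derive_quotient with (fun s => Re (q s)).
  - intros s. rewrite (E s). unfold Re, Im; simpl. ring.
  - now apply clim_Re.
Qed.

Lemma rderiv_Im (p : R -> C) (t : R) (l : C) :
  rderiv p t l -> is_derive (fun s => Im (p s)) t (Im l).
Proof.
  intros [q [E [_ H]]]. apply is_derive_quotient with (fun s => Im (q s)).
  - intros s. rewrite (E s). unfold Re, Im; simpl. ring.
  - now apply clim_Im.
Qed.

Lemma rderiv_affine (a b : C) (t : R) : rderiv (fun s => a + RtoC s * b) t b.
Proof.
  exists (fun _ => b). split; [|split; [reflexivity|apply clim_const]].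
  intros s. rewrite RtoC_minus. ring.
Qed.

Lemma hol_cont (z : C) (f : C -> C) : hol z f -> ccont f z.
Proof.
  intros [f' H]. destruct (nbhd_center _ _ H) as [H1 _]. now apply cderiv_cont with (f' z).
Qed.

Lemma hol_ext (z : C) (f g : C -> C) :
  nbhd z (fun w => f w = g w) -> hol z f -> hol z g.
Proof.
  intros E [f' H]. exists f'. apply nbhd_nbhd in E.
  generalize (filter_and _ _ E H). apply filter_imp. intros w [Ew [H1 H2]].
  split; auto. now apply cderiv_ext with f.
Qed.

Lemma hol_const (c z : C) : hol z (fun _ => c).
Proof.
  exists (fun _ => 0). apply filter_forall. intros w.
  split; [apply cderiv_const|apply clim_const].
Qed.

Lemma hol_id (z : C) : hol z (fun w => w).
Proof.
  exists (fun _ => 1). apply filter_forall. intros w.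
  split; [apply cderiv_id|apply clim_const].
Qed.

Lemma hol_plus (z : C) (f g : C -> C) :
  hol z f -> hol z g -> hol z (fun w => f w + g w).
Proof.
  intros [f' Hf] [g' Hg]. exists (fun w => f' w + g' w).
  generalize (filter_and _ _ Hf Hg). apply filter_imp. intros w [[H1 H2] [H3 H4]].
  split; [now apply cderiv_plus|now apply clim_plus].
Qed.

Lemma hol_mult (z : C) (f g : C -> C) :
  hol z f -> hol z g -> hol z (fun w => f w * g w).
Proof.
  intros [f' Hf] [g' Hg]. exists (fun w => f' w * g w + f w * g' w).
  generalize (filter_and _ _ Hf Hg). apply filter_imp. intros w [[H1 H2] [H3 H4]].
  split; [now apply cderiv_mult|].
  apply clim_plus; apply clim_mult; auto; eapply cderiv_cont; eauto.
Qed.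

Lemma hol_comp (z : C) (f g : C -> C) :
  hol (g z) f -> hol z g -> hol z (fun w => f (g w)).
Proof.
  intros [f' Hf] Hg. assert (Hc := hol_cont _ _ Hg). destruct Hg as [g' Hg].
  exists (fun w => f' (g w) * g' w).
  generalize (filter_and _ _ (clim_nbhd _ _ _ Hc Hf) Hg).
  apply filter_imp. intros w [[H1 H2] [H3 H4]].
  split; [now apply cderiv_comp|].
  apply clim_mult; auto. apply clim_comp; auto. eapply cderiv_cont; eauto.
Qed.

Lemma hol_inv (z : C) (f : C -> C) : f z <> 0 -> hol z f -> hol z (fun w => / f w).
Proof.
  intros Hz Hf. apply (hol_comp z Cinv f); auto.
  exists (fun w => - / (w * w)).
  generalize (clim_neq0 _ _ Hz (clim_id (f z))). apply filter_imp. intros w Hw.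
  split; [now apply cderiv_inv|]. apply clim_opp, clim_inv.
  - now apply Cmult_neq_0.
  - apply clim_mult; apply clim_id.
Qed.

Lemma hol_opp (z : C) (f : C -> C) : hol z f -> hol z (fun w => - f w).
Proof.
  intros H. apply hol_ext with (fun w => - (1) * f w).
  - apply filter_forall. intros w. ring.
  - apply hol_mult; auto. apply hol_const.
Qed.

Lemma hol_minus (z : C) (f g : C -> C) :
  hol z f -> hol z g -> hol z (fun w => f w - g w).
Proof. intros Hf Hg. apply hol_plus; auto. now apply hol_opp. Qed.

Lemma hol_div (z : C) (f g : C -> C) :
  g z <> 0 -> hol z f -> hol z g -> hol z (fun w => f w / g w).
Proof. intros Hz Hf Hg. apply hol_mult; auto. now apply hol_inv. Qed.

Lemma hol_pow (z : C) (f : C -> C) (n : nat) : hol z f -> hol z (fun w => f w ^ n).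
Proof.
  intros Hf. induction n as [|n IH].
  - apply (hol_const 1).
  - apply hol_ext with (fun w => f w * f w ^ n).
    + apply filter_forall. intros w. now rewrite Cpow_S.
    + now apply hol_mult.
Qed.

(* The factor 2 comes from applying the real mean value theorem to the real and
   imaginary parts separately. *)
Lemma cderiv_lipschitz (f f' : C -> C) (c : C) (d K : R) :
  (forall w, Cmod (w - c) < d -> cderiv f w (f' w) /\ Cmod (f' w) <= K) ->
  forall a b, Cmod (a - c) < d -> Cmod (b - c) < d ->
  Cmod (f a - f b) <= 2 * K * Cmod (a - b).
Proof.
  intros H a b Ha Hb.
  assert (Hseg : forall t, 0 <= t <= 1 -> Cmod (b + RtoC t * (a - b) - c) < d).
  { intros t Ht.
    replace (b + RtoC t * (a - b) - c) with (RtoC t * (a - c) + RtoC (1 - t) * (b - c))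
      by (rewrite RtoC_minus; ring).
    eapply Rle_lt_trans; [apply Cmod_triangle|].
    rewrite !Cmod_mult, !Cmod_R, (Rabs_right t), (Rabs_right (1 - t)) by lra.
    apply Rle_lt_trans with (Rmax (Cmod (a - c)) (Cmod (b - c))); [|now apply Rmax_lub_lt].
    generalize (Rmax_l (Cmod (a - c)) (Cmod (b - c))) (Rmax_r (Cmod (a - c)) (Cmod (b - c))).
    nra. }
  assert (Hd : forall t, 0 <= t <= 1 -> rderiv (fun s => f (b + RtoC s * (a - b))) t
    (f' (b + RtoC t * (a - b)) * (a - b))).
  { intros t Ht. apply (cderiv_rderiv f (fun s => b + RtoC s * (a - b))).
    - apply H. auto.
    - apply rderiv_affine. }
  assert (HB : forall t, 0 <= t <= 1 ->
    Cmod (f' (b + RtoC t * (a - b)) * (a - b)) <= K * Cmod (a - b)).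
  { intros t Ht. rewrite Cmod_mult. apply Rmult_le_compat_r; [apply Cmod_ge_0|].
    apply H. auto. }
  assert (E1 : b + RtoC 1 * (a - b) = a) by ring.
  assert (E0 : b + RtoC 0 * (a - b) = b) by ring.
  eapply Rle_trans; [apply Cmod_le_components|].
  replace (2 * K * Cmod (a - b))%R with (K * Cmod (a - b) + K * Cmod (a - b))%R by ring.
  apply Rplus_le_compat.
  - destruct (MVT_gen (fun s => Re (f (b + RtoC s * (a - b)))) 0 1
      (fun t => Re (f' (b + RtoC t * (a - b)) * (a - b)))) as [t [Ht E]].
    + rewrite Rmin_left, Rmax_right by lra. intros t Ht. apply rderiv_Re, Hd. lra.
    + rewrite Rmin_left, Rmax_right by lra. intros t Ht.
      eapply is_derive_continuity_pt, rderiv_Re, Hd. lra.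
    + rewrite Rmin_left, Rmax_right in Ht by lra. cbv beta in E. rewrite E1, E0 in E.
      change (Re (f a - f b)) with (Re (f a) - Re (f b))%R. rewrite E, Rminus_0_r, Rmult_1_r.
      eapply Rle_trans; [apply re_le_Cmod|]. auto.
  - destruct (MVT_gen (fun s => Im (f (b + RtoC s * (a - b)))) 0 1
      (fun t => Im (f' (b + RtoC t * (a - b)) * (a - b)))) as [t [Ht E]].
    + rewrite Rmin_left, Rmax_right by lra. intros t Ht. apply rderiv_Im, Hd. lra.
    + rewrite Rmin_left, Rmax_right by lra. intros t Ht.
      eapply is_derive_continuity_pt, rderiv_Im, Hd. lra.
    + rewrite Rmin_left, Rmax_right in Ht by lra. cbv beta in E. rewrite E1, E0 in E.
      change (Im (f a - f b)) with (Im (f a) - Im (f b))%R. rewrite E, Rminus_0_r, Rmult_1_r.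
      eapply Rle_trans; [apply im_le_Cmod|]. auto.
Qed.

(** * Convergent power series are holomorphic *)

Notation cseries := (@is_series C_AbsRing C_NormedModule).
Notation cpseries := (@is_pseries C_AbsRing C_NormedModule).
Notation csum := (@sum_n C_AbelianMonoid).

Lemma cpseries_cseries (a : nat -> C) (z l : C) :
  cpseries a z l <-> cseries (fun n => z ^ n * a n) l.
Proof. reflexivity. Qed.

Lemma cseries_clim (t : nat -> C) (l : C) :
  cseries t l <-> clim eventually (csum t) l.
Proof. symmetry. apply clim_filterlim. Qed.

Lemma csum_S (t : nat -> C) (n : nat) : csum t (S n) = csum t n + t (S n).
Proof. exact (@sum_Sn C_AbelianMonoid t n). Qed.

Lemma csum_0 (t : nat -> C) : csum t 0 = t 0%nat.
Proof. exact (@sum_O C_AbelianMonoid t). Qed.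

Lemma cseries_Cmod_le (t : nat -> C) (l : C) (B : R) :
  cseries t l -> (forall N, Cmod (csum t N) <= B) -> Cmod l <= B.
Proof.
  intros H HB. apply cseries_clim in H. apply Rnot_lt_le. intros Hl.
  assert (He : 0 < Cmod l - B) by lra.
  destruct (H _ He) as [N HN]. specialize (HN N (Nat.le_refl N)). specialize (HB N).
  rewrite Cmod_minus_sym in HN. generalize (Cmod_minus_triangle l (csum t N)). lra.
Qed.

Lemma cseries_terms_bounded (t : nat -> C) (l : C) :
  cseries t l -> exists M, forall n, Cmod (t n) <= M.
Proof.
  intros H. destruct (@filterlim_bounded C_AbsRing C_NormedModule (csum t)) as [M HM].
  { exists l. exact H. }
  exists (2 * M)%R. intros n.
  assert (HM' : forall n, Cmod (csum t n) <= M) by exact HM.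
  destruct n as [|n].
  - rewrite <- csum_0. generalize (HM' 0%nat) (Cmod_ge_0 (csum t 0)). lra.
  - replace (t (S n)) with (csum t (S n) - csum t n) by (rewrite csum_S; ring).
    eapply Rle_trans; [apply Cmod_triangle|]. rewrite Cmod_opp.
    generalize (HM' n) (HM' (S n)). lra.
Qed.

(** Subtracting [M * (1 / 2) ^ N] makes the induction close: for ratio 1/2 the tail still available
    equals the last bound, and the next term uses exactly half of it. *)
Lemma csum_geom_bound (t : nat -> C) (M : R) (N : nat) :
  (forall n, Cmod (t n) <= M * (1 / 2) ^ n) ->
  Cmod (csum t N) <= 2 * M - M * (1 / 2) ^ N.
Proof.
  intros H. induction N as [|N IH].
  - rewrite csum_0. generalize (H 0%nat). simpl. lra.
  - rewrite csum_S. eapply Rle_trans; [apply Cmod_triangle|].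
    generalize (H (S N)). simpl. simpl in IH. lra.
Qed.

Lemma cseries_plus (s t : nat -> C) (a b : C) :
  cseries s a -> cseries t b -> cseries (fun n => s n + t n) (a + b).
Proof. apply (@is_series_plus C_AbsRing C_NormedModule). Qed.

Lemma cseries_scal (c : C) (t : nat -> C) (l : C) :
  cseries t l -> cseries (fun n => c * t n) (c * l).
Proof. apply (@is_series_scal C_AbsRing C_NormedModule). Qed.

Lemma cseries_ext (s t : nat -> C) (l : C) :
  (forall n, s n = t n) -> cseries s l -> cseries t l.
Proof. apply (@is_series_ext C_AbsRing C_NormedModule). Qed.

Lemma cseries_exists (t : nat -> C) (M : R) :
  (forall n, Cmod (t n) <= M * (1 / 2) ^ n) -> exists l : C, cseries t l.
Proof.
  intros H.
  apply (@ex_series_le C_AbsRing C_CompleteNormedModule t (fun n => M * (1 / 2) ^ n)%R).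
  - exact H.
  - apply (ex_series_scal_l M (fun n => (1 / 2) ^ n)%R).
    apply ex_series_geom. rewrite Rabs_right; lra.
Qed.

Definition pderiv (a : nat -> C) (n : nat) : C := RtoC (INR (S n)) * a (S n).

Lemma INR_le_pow2 (n : nat) : INR (S n) <= 2 ^ n.
Proof.
  induction n as [|n IH]; [simpl; lra|]. rewrite S_INR.
  assert (1 <= 2 ^ n) by (apply pow_R1_Rle; lra). simpl pow. lra.
Qed.

(** The derivative of the [n]-th power. For [n = 0] the truncated exponent is harmless, since the
    factor [INR 0] vanishes. *)
Definition dpow (n : nat) (w : C) : C := RtoC (INR n) * w ^ pred n.

Lemma dpow_S (n : nat) (w : C) : dpow (S n) w = w ^ n + w * dpow n w.
Proof.
  unfold dpow. rewrite S_INR, RtoC_plus. destruct n as [|n].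
  - simpl. ring.
  - simpl pred. rewrite (Cpow_S w n). ring.
Qed.

(** The remainder of degree n + 1 is z times the remainder of degree n plus [dpow n w] times (z -
    w)^2. Each summand is at most 4^n rho^(n+1) times the last factor, so a factor 4 per degree is
    more than enough. The exact quadratic count is given up because only a geometric bound is
    wanted. *)
Lemma pow_taylor2 (rho : R) (z w : C) (n : nat) :
  0 < rho -> Cmod z <= rho -> Cmod w <= rho ->
  Cmod (z ^ n - w ^ n - dpow n w * (z - w))
    <= 4 ^ n * rho ^ n * (Cmod (z - w) ^ 2 / rho ^ 2).
Proof.
  intros Hr Hz Hw. set (D := (Cmod (z - w) ^ 2 / rho ^ 2)%R).
  assert (HD : 0 <= D).
  { apply Rdiv_le_0_compat; [apply pow2_ge_0|]. apply pow_lt. auto. }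
  assert (Hd : forall n, Cmod (dpow n w) * rho <= 4 ^ n * rho ^ n).
  { clear n. intros n. unfold dpow. rewrite Cmod_mult, Cmod_R, Cmod_pow.
    rewrite Rabs_right by apply Rle_ge, pos_INR. destruct n as [|n].
    - simpl. lra.
    - simpl pred.
      assert (H1 : Cmod w ^ n <= rho ^ n) by (apply pow_incr; split; [apply Cmod_ge_0|auto]).
      assert (H2 := INR_le_pow2 n). assert (H3 := pos_INR (S n)).
      assert (H4 : 2 ^ n <= 4 ^ n) by (apply pow_incr; lra).
      assert (H5 : 0 <= Cmod w ^ n) by (apply pow_le, Cmod_ge_0).
      assert (H6 : 0 < rho ^ n) by (apply pow_lt; auto).
      apply Rle_trans with (4 ^ n * rho ^ n * rho)%R.
      + apply Rmult_le_compat_r; [lra|]. apply Rmult_le_compat; lra.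
      + change (rho ^ S n)%R with (rho * rho ^ n)%R. change (4 ^ S n)%R with (4 * 4 ^ n)%R.
        assert (0 < 4 ^ n) by (apply pow_lt; lra).
        assert (0 < 4 ^ n * rho ^ n * rho) by (repeat apply Rmult_lt_0_compat; auto).
        nra. }
  induction n as [|n IH].
  - replace (z ^ 0 - w ^ 0 - dpow 0 w * (z - w)) with (RtoC 0).
    + rewrite Cmod_0. simpl. nra.
    + unfold dpow. simpl. ring.
  - replace (z ^ S n - w ^ S n - dpow (S n) w * (z - w))
      with (z * (z ^ n - w ^ n - dpow n w * (z - w)) + dpow n w * ((z - w) * (z - w))).
    2:{ rewrite dpow_S, !Cpow_S. destruct n as [|n].
        - unfold dpow. simpl. ring.
        - unfold dpow. simpl pred. rewrite (Cpow_S w n). ring. }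
    eapply Rle_trans; [apply Cmod_triangle|]. rewrite !Cmod_mult.
    assert (HE : (Cmod (z - w) * Cmod (z - w) = D * rho * rho)%R).
    { unfold D. field. lra. }
    rewrite HE.
    assert (H4 : 0 < 4 ^ n) by (apply pow_lt; lra).
    assert (H5 : 0 < rho ^ n) by (apply pow_lt; lra).
    assert (HP : 0 <= 4 ^ n * rho ^ n * D * rho).
    { apply Rmult_le_pos; [|lra]. apply Rmult_le_pos; [|lra]. apply Rmult_le_pos; lra. }
    assert (K1 : Cmod z * Cmod (z ^ n - w ^ n - dpow n w * (z - w))
      <= rho * (4 ^ n * rho ^ n * D)).
    { apply Rmult_le_compat; auto using Cmod_ge_0. }
    assert (K2 : Cmod (dpow n w) * (D * rho * rho) <= 4 ^ n * rho ^ n * (D * rho)).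
    { replace (Cmod (dpow n w) * (D * rho * rho))%R with (Cmod (dpow n w) * rho * (D * rho))%R
        by ring.
      apply Rmult_le_compat_r; auto. apply Rmult_le_pos; lra. }
    simpl pow. nra.
Qed.

(** At the real point [d / 2] inside the disc of convergence the terms of the series are bounded,
    which is a Cauchy estimate of radius [r = d / 2]. *)
Lemma expansion_coef_bound (f : C -> C) (a : nat -> C) :
  has_expansion f a -> exists M r, 0 < r /\ 0 <= M /\
    (forall n, Cmod (a n) * r ^ n <= M) /\ forall z, Cmod z < r -> cpseries a z (f z).
Proof.
  intros H. apply nbhd_iff in H. destruct H as [d [Hd H]].
  assert (Hm : Cmod (RtoC (d / 2)) = (d / 2)%R) by (rewrite Cmod_R, Rabs_right; lra).
  assert (H0 : cpseries a (RtoC (d / 2)) (f (RtoC (d / 2)))).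
  { apply H. rewrite Cminus_0_r, Hm. lra. }
  destruct (cseries_terms_bounded _ _ H0) as [M HM].
  exists M, (d / 2)%R. split; [lra|]. split; [|split].
  - eapply Rle_trans; [apply Cmod_ge_0|apply (HM 0%nat)].
  - intros n. rewrite Rmult_comm, <- Hm at 1. rewrite <- Cmod_pow, <- Cmod_mult. apply HM.
  - intros z Hz. apply H. rewrite Cminus_0_r. lra.
Qed.

Lemma pow_mult_frac (r c : R) (n : nat) : 0 < r -> ((c * r) ^ n = r ^ n * c ^ n)%R.
Proof. intros Hr. rewrite Rpow_mult_distr. ring. Qed.

(** Summing the Taylor remainders of the powers against the coefficients bounds the remainder of [f]
    by a constant times |z - w|^2, uniformly on a smaller disc; this yields the derivative at every
    [w] of the disc at once. *)
Lemma expansion_deriv (f : C -> C) (a : nat -> C) :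
  has_expansion f a ->
  exists f', has_expansion f' (pderiv a) /\ near0 (fun w => cderiv f w (f' w)).
Proof.
  intros H. destruct (expansion_coef_bound f a H) as [M [r [Hr [HM0 [HM Hf]]]]].
  (* The factor 1/8 turns the growth [4 ^ n] of [pow_taylor2] into the ratio 1/2 of
     [csum_geom_bound]. For the derived series, [2 * (1 / 8)] also stays below 1/2. *)
  set (rho := (1 / 8 * r)%R). assert (Hrho : 0 < rho) by (unfold rho; lra).
  assert (Hrp : forall n, 0 < r ^ n) by (intros; apply pow_lt; auto).
  (* Stated for every [w], with an arbitrary value outside the disc, so that choice produces a total
     function. *)
  assert (Hex : forall w, exists l : C, Cmod w < rho -> cpseries (pderiv a) w l).
  { intros w. destruct (Rlt_dec (Cmod w) rho) as [Hw|Hn]; [|exists (RtoC 0); easy].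
    destruct (cseries_exists (fun n => w ^ n * pderiv a n) (M / r)) as [l Hl].
    - intros n. unfold pderiv. rewrite !Cmod_mult, Cmod_pow, Cmod_R.
      rewrite Rabs_right by apply Rle_ge, pos_INR.
      assert (H1 : Cmod w ^ n <= rho ^ n) by (apply pow_incr; split; [apply Cmod_ge_0|lra]).
      assert (H2 := INR_le_pow2 n).
      assert (H3 : Cmod (a (S n)) <= M / (r * r ^ n)).
      { apply Rle_div_r; [apply Rmult_lt_0_compat; auto|]. apply (HM (S n)). }
      assert (H5 : 0 <= Cmod w ^ n) by (apply pow_le, Cmod_ge_0).
      apply Rle_trans with (rho ^ n * (2 ^ n * (M / (r * r ^ n))))%R.
      + repeat apply Rmult_le_compat; auto using Cmod_ge_0, pos_INR.
        apply Rmult_le_pos; auto using Cmod_ge_0, pos_INR.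
      + unfold rho. rewrite pow_mult_frac by auto.
        replace (r ^ n * (1 / 8) ^ n * (2 ^ n * (M / (r * r ^ n))))%R
          with (M / r * ((1 / 8) ^ n * 2 ^ n))%R by (field; split; [apply Rgt_not_eq, Hrp|lra]).
        rewrite <- Rpow_mult_distr.
        apply Rmult_le_compat_l; [apply Rdiv_le_0_compat; lra|].
        apply pow_incr. lra.
    - exists l. intros _. exact Hl. }
  set (f' := fun w => proj1_sig (constructive_indefinite_description _ (Hex w))).
  assert (Hf' : forall w, Cmod w < rho -> cpseries (pderiv a) w (f' w)).
  { intros w. exact (proj2_sig (constructive_indefinite_description _ (Hex w))). }
  clearbody f'.
  exists f'. split.
  { apply nbhd_iff. exists rho. split; auto. intros w Hw. rewrite Cminus_0_r in Hw. auto. }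
  set (K := (2 * M / rho ^ 2)%R).
  assert (Hest : forall z w, Cmod z < rho -> Cmod w < rho ->
    Cmod (f z - f w - f' w * (z - w)) <= K * Cmod (z - w) ^ 2).
  { intros z w Hz Hw.
    assert (S1 : cseries (fun n => a n * (z ^ n - w ^ n - dpow n w * (z - w)))
      (f z - f w - f' w * (z - w))).
    (* The derived series is shifted by one index; the added term of degree 0 vanishes because
       [dpow 0 w] is 0. *)
    { assert (Sd : cseries (fun n => a n * dpow n w) (f' w)).
      { assert (Hf'w := Hf' w Hw). apply (@is_series_decr_1 C_AbsRing C_NormedModule).
        apply cseries_ext with (fun n => w ^ n * pderiv a n).
        - intros n. unfold pderiv, dpow. simpl pred. ring.
        - assert (E : f' w = f' w + - (a 0%nat * dpow 0 w)) by (unfold dpow; simpl; ring).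
          rewrite E in Hf'w at 1. exact Hf'w. }
      assert (Sz : cseries (fun n => z ^ n * a n) (f z)) by (apply Hf; unfold rho in Hz; lra).
      assert (Sw : cseries (fun n => w ^ n * a n) (f w)) by (apply Hf; unfold rho in Hw; lra).
      apply (cseries_scal (- (1))) in Sw. apply (cseries_scal (- (z - w))) in Sd.
      replace (f z - f w - f' w * (z - w))
        with (f z + (- (1) * f w + - (z - w) * f' w)) by ring.
      eapply cseries_ext; [|apply cseries_plus; [exact Sz|apply cseries_plus; [exact Sw|exact Sd]]].
      intros n. cbv beta. ring. }
    apply (cseries_Cmod_le _ _ _ S1). intros N.
    assert (HD : 0 <= Cmod (z - w) ^ 2 / rho ^ 2).
    { apply Rdiv_le_0_compat; [apply pow2_ge_0|]. apply pow_lt. auto. }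
    eapply Rle_trans; [apply (csum_geom_bound _ (M * (Cmod (z - w) ^ 2 / rho ^ 2)))|].
    - intros n. rewrite Cmod_mult.
      assert (H1 := pow_taylor2 rho z w n Hrho ltac:(lra) ltac:(lra)).
      assert (H3 : Cmod (a n) <= M / r ^ n).
      { apply Rle_div_r; [apply Rlt_gt, Hrp|apply HM]. }
      eapply Rle_trans; [apply Rmult_le_compat; [apply Cmod_ge_0|apply Cmod_ge_0|exact H3|exact H1]|].
      unfold rho at 1. rewrite pow_mult_frac by auto.
      replace (M / r ^ n * (4 ^ n * (r ^ n * (1 / 8) ^ n) * (Cmod (z - w) ^ 2 / rho ^ 2)))%R
        with (M * (Cmod (z - w) ^ 2 / rho ^ 2) * (4 ^ n * (1 / 8) ^ n))%R
        by (field; split; apply Rgt_not_eq; [apply Hrho|apply Hrp]).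
      rewrite <- Rpow_mult_distr. replace (4 * (1 / 8))%R with (1 / 2)%R by field. lra.
    - assert (0 <= M * (Cmod (z - w) ^ 2 / rho ^ 2) * (1 / 2) ^ N).
      { apply Rmult_le_pos; [apply Rmult_le_pos; auto|apply pow_le; lra]. }
      replace (K * Cmod (z - w) ^ 2)%R with (2 * (M * (Cmod (z - w) ^ 2 / rho ^ 2)))%R.
      + lra.
      + unfold K. field. lra. }
  apply nbhd_iff. exists rho. split; auto. intros w Hw. rewrite Cminus_0_r in Hw.
  set (q := fun z => if Ceq_dec z w then f' w else (f z - f w) / (z - w)).
  assert (Hqw : q w = f' w) by (unfold q; destruct (Ceq_dec w w); easy).
  apply cderiv_of_quotient with q; auto.
  { apply filter_forall. intros z Hz. unfold q. destruct (Ceq_dec z w); [easy|].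
    field. now apply Cminus_eq_contra. }
  intros eps Heps.
  assert (HK : 0 <= K) by (unfold K; apply Rdiv_le_0_compat; [lra|apply pow_lt; auto]).
  apply nbhd_iff. exists (Rmin (rho - Cmod w) (eps / (K + 1))). split.
  { apply Rmin_glb_lt; [lra|]. apply Rdiv_lt_0_compat; lra. }
  intros z Hz. rewrite Hqw.
  assert (Hz1 : Cmod (z - w) < rho - Cmod w) by (eapply Rlt_le_trans; [exact Hz|apply Rmin_l]).
  assert (Hz2 : Cmod (z - w) < eps / (K + 1)) by (eapply Rlt_le_trans; [exact Hz|apply Rmin_r]).
  unfold q. destruct (Ceq_dec z w) as [E|Hn].
  { replace (f' w - f' w) with (RtoC 0) by ring. now rewrite Cmod_0. }
  assert (Hzr : Cmod z < rho).
  { generalize (Cmod_minus_triangle z w). lra. }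
  apply Cminus_eq_contra in Hn.
  replace ((f z - f w) / (z - w) - f' w) with ((f z - f w - f' w * (z - w)) / (z - w))
    by (field; auto).
  rewrite Cmod_div by auto. apply Cmod_gt_0 in Hn.
  apply Rle_lt_trans with (K * Cmod (z - w))%R.
  - apply Rle_div_l; auto. generalize (Hest z w Hzr Hw). simpl. lra.
  - apply Rlt_div_r in Hz2; [|lra]. nra.
Qed.

(** The series is differentiated twice: the second derivative supplies the continuity of the
    first. *)
Lemma analytic0_hol (f : C -> C) : analytic0 f -> hol 0 f.
Proof.
  intros [a H]. destruct (expansion_deriv f a H) as [f' [H1 H2]].
  destruct (expansion_deriv f' _ H1) as [f'' [_ H3]].
  exists f'. generalize (filter_and _ _ H2 H3). apply filter_imp.
  intros w [K1 K2]. split; auto. now apply cderiv_cont with (f'' w).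
Qed.

Lemma expansion_at0 (f : C -> C) (a : nat -> C) : has_expansion f a -> f 0 = a 0%nat.
Proof.
  intros H. assert (H0 := nbhd_center _ _ H). apply cpseries_cseries, cseries_clim in H0.
  apply (clim_unique _ _ _ _ H0). apply clim_ext with (fun _ => a 0%nat); [|apply clim_const].
  apply filter_forall. intros n. induction n as [|n IH].
  - rewrite csum_0. change (a 0%nat = 0 ^ 0 * a 0%nat). simpl. ring.
  - rewrite csum_S, <- IH. change (a 0%nat = a 0%nat + 0 ^ S n * a (S n)). rewrite Cpow_S. ring.
Qed.

Lemma expansion_decr (f : C -> C) (a : nat -> C) :
  has_expansion f a ->
  exists f1, has_expansion f1 (fun n => a (S n)) /\ near0 (fun z => f z = a 0%nat + z * f1 z).
Proof.
  (* The value at 0 must be [a 1], since the expansion is required on a full neighborhood, 0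
     included. *)
  intros H. set (f1 := fun z => if Ceq_dec z 0 then a 1%nat else (f z - a 0%nat) / z).
  exists f1. split.
  - generalize H. unfold has_expansion. apply filter_imp. intros z Hz. unfold f1.
    destruct (Ceq_dec z 0) as [->|Hn].
    + apply (@is_series_decr_1 C_AbsRing C_NormedModule).
      apply cseries_clim. apply clim_ext with (fun _ => 0).
      * apply filter_forall. intros n. induction n as [|n IH].
        -- rewrite csum_0. change (RtoC 0 = RtoC 0 ^ 1 * a 2%nat). rewrite Cpow_S. ring.
        -- rewrite csum_S, <- IH.
           change (RtoC 0 = RtoC 0 + RtoC 0 ^ S (S n) * a (S (S (S n)))). rewrite Cpow_S. ring.
      * apply clim_eq with (RtoC 0); [apply clim_const|].
        change (RtoC 0 = a 1%nat + - (RtoC 0 ^ 0 * a 1%nat)). simpl. ring.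
    + apply (is_pseries_decr_1 a z (/ z) (f z)) in Hz.
      * replace ((f z - a 0%nat) / z) with (/ z * (f z + - a 0%nat)) by (field; auto).
        exact Hz.
      * apply Cinv_l. auto.
  - apply filter_forall. intros z. unfold f1. destruct (Ceq_dec z 0) as [->|Hn].
    + rewrite (expansion_at0 f a H). ring.
    + field. auto.
Qed.

Lemma expansion_incr (f : C -> C) (a : nat -> C) :
  has_expansion f a -> has_expansion (fun z => z * f z) (@PS_incr_1 C_AbsRing C_NormedModule a).
Proof.
  unfold has_expansion. apply filter_imp. intros z Hz. exact (is_pseries_incr_1 a z (f z) Hz).
Qed.

Lemma expansion_ext (f g : C -> C) (a : nat -> C) :
  near0 (fun z => f z = g z) -> has_expansion f a -> has_expansion g a.
Proof.
  unfold has_expansion. intros E H. generalize (filter_and _ _ E H). apply filter_imp. now intros z [<- Hz].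
Qed.

(** * The Cauchy formula: holomorphic germs are analytic *)

Lemma rderiv_pair (a b : R -> R) (t la lb : R) :
  is_derive a t la -> is_derive b t lb -> rderiv (fun s => (a s, b s) : C) t (la, lb).
Proof.
  assert (Hq : forall (u : R -> R) l, is_derive u t l ->
    filterlim (fun s => if Req_EM_T s t then l else ((u s - u t) / (s - t))%R)
      (locally t) (locally l)).
  { intros u l H. apply is_derive_Reals in H. intros P [eps HP].
    destruct (H eps (cond_pos eps)) as [d Hd]. exists d. intros s Hs. apply HP.
    destruct (Req_EM_T s t) as [E|Hn]; [apply ball_center|].
    specialize (Hd (s - t)%R ltac:(lra) Hs).
    rewrite (Rplus_minus t s : (t + (s - t))%R = s) in Hd. exact Hd. }
  intros Ha Hb.
  exists (fun s => (if Req_EM_T s t then la else ((a s - a t) / (s - t))%R,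
                    if Req_EM_T s t then lb else ((b s - b t) / (s - t))%R)).
  split; [|split].
  - intros s. destruct (Req_EM_T s t) as [->|Hn].
    + rewrite Rminus_diag. unfold Cplus, Cmult, RtoC; simpl. f_equal; ring.
    + unfold Cplus, Cmult, RtoC; simpl. f_equal; field; lra.
  - now destruct (Req_EM_T t t).
  - apply (clim_pair (fun s => if Req_EM_T s t then la else ((a s - a t) / (s - t))%R)
      (fun s => if Req_EM_T s t then lb else ((b s - b t) / (s - t))%R)); auto.
Qed.

Lemma rderiv_clim (p : R -> C) (t : R) (l : C) : rderiv p t l -> clim (locally t) p (p t).
Proof.
  intros H.
  apply clim_ext with (fun s => (Re (p s), Im (p s))).
  { apply filter_forall. intros s. now destruct (p s). }
  apply clim_eq with (Re (p t), Im (p t)); [|now destruct (p t)].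
  apply clim_pair.
  - apply (ex_derive_continuous (K := R_AbsRing) (V := R_NormedModule) (fun s => Re (p s))).
    eexists. apply rderiv_Re. eassumption.
  - apply (ex_derive_continuous (K := R_AbsRing) (V := R_NormedModule) (fun s => Im (p s))).
    eexists. apply rderiv_Im. eassumption.
Qed.

Lemma rderiv_scal_l (c : C) (p : R -> C) (t : R) (l : C) :
  rderiv p t l -> rderiv (fun s => c * p s) t (c * l).
Proof.
  intros [q [E [H1 H2]]]. exists (fun s => c * q s). split; [|split].
  - intros s. rewrite (E s). ring.
  - now rewrite H1.
  - apply clim_mult; auto. apply clim_const.
Qed.

Lemma rderiv_shift (c : C) (p : R -> C) (t : R) (l : C) :
  rderiv p t l -> rderiv (fun s => c + p s) t l.
Proof.
  intros [q [E [H1 H2]]]. exists q. split; [|split]; auto.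
  intros s. rewrite (E s). ring.
Qed.

Lemma cderiv_pow (n : nat) (z : C) : cderiv (fun w => w ^ n) z (dpow n z).
Proof.
  induction n as [|n IH].
  - unfold dpow. simpl INR. rewrite Cmult_0_l. apply (cderiv_const 1).
  - rewrite dpow_S. apply cderiv_ext with (fun w => w * w ^ n).
    { apply filter_forall. intros w. now rewrite Cpow_S. }
    replace (z ^ n + z * dpow n z) with (1 * z ^ n + z * dpow n z) by ring.
    apply cderiv_mult; auto. apply cderiv_id.
Qed.

Lemma clim_snd (u : R -> C) (t s : R) (l : C) :
  clim (locally s) u l -> clim (locally (t, s)) (fun p : R * R => u (snd p)) l.
Proof.
  intros H eps Heps. destruct (H eps Heps) as [d Hd].
  exists d. intros [a b] [_ Hb]. now apply Hd.
Qed.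

(** * Complex-valued integrals in the angle over one period *)

Definition rcont (G : R -> C) : Prop := forall t, clim (locally t) G (G t).

Definition cint (G : R -> C) : C :=
  (RInt (fun t => Re (G t)) 0 (2 * PI), RInt (fun t => Im (G t)) 0 (2 * PI)).

Lemma rcont_ex_RInt (G : R -> C) (a b : R) : rcont G ->
  ex_RInt (fun t => Re (G t)) a b /\ ex_RInt (fun t => Im (G t)) a b.
Proof.
  intros H. split; apply (ex_RInt_continuous (V := R_CompleteNormedModule)); intros t _.
  - apply clim_Re, H.
  - apply clim_Im, H.
Qed.

Lemma cint_ext (G G' : R -> C) : (forall t, G t = G' t) -> cint G = cint G'.
Proof.
  intros H. unfold cint. f_equal; apply RInt_ext; intros t _; now rewrite H.
Qed.

Lemma C_eq (a b : C) : Re a = Re b -> Im a = Im b -> a = b.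
Proof. destruct a, b. simpl. now intros -> ->. Qed.

Lemma cint_plus (G G' : R -> C) : rcont G -> rcont G' ->
  cint (fun t => G t + G' t) = cint G + cint G'.
Proof.
  intros H H'. destruct (rcont_ex_RInt G 0 (2 * PI) H), (rcont_ex_RInt G' 0 (2 * PI) H').
  apply C_eq; simpl.
  - apply (RInt_plus (V := R_CompleteNormedModule) (fun t => Re (G t)) (fun t => Re (G' t))); auto.
  - apply (RInt_plus (V := R_CompleteNormedModule) (fun t => Im (G t)) (fun t => Im (G' t))); auto.
Qed.

Lemma Re_mult (a b : C) : Re (a * b) = (Re a * Re b + - Im a * Im b)%R.
Proof. unfold Re, Im; simpl. ring. Qed.

Lemma Im_mult (a b : C) : Im (a * b) = (Im a * Re b + Re a * Im b)%R.
Proof. unfold Re, Im; simpl. ring. Qed.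

Lemma cint_scal (c : C) (G : R -> C) : rcont G ->
  cint (fun t => c * G t) = c * cint G.
Proof.
  intros H. destruct (rcont_ex_RInt G 0 (2 * PI) H) as [H1 H2].
  assert (L : forall a b, RInt (fun t => a * Re (G t) + b * Im (G t))%R 0 (2 * PI)
    = (a * RInt (fun t => Re (G t)) 0 (2 * PI) + b * RInt (fun t => Im (G t)) 0 (2 * PI))%R).
  { intros a b.
    rewrite (RInt_plus (V := R_CompleteNormedModule)
      (fun t => a * Re (G t))%R (fun t => b * Im (G t))%R).
    - apply (f_equal2 Rplus).
      + apply (RInt_scal (V := R_CompleteNormedModule) (fun t => Re (G t)) 0 (2 * PI) a); auto.
      + apply (RInt_scal (V := R_CompleteNormedModule) (fun t => Im (G t)) 0 (2 * PI) b); auto.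
    - apply (ex_RInt_scal (V := R_CompleteNormedModule) (fun t => Re (G t)) 0 (2 * PI) a); auto.
    - apply (ex_RInt_scal (V := R_CompleteNormedModule) (fun t => Im (G t)) 0 (2 * PI) b); auto. }
  apply C_eq.
  - transitivity (RInt (fun t => Re c * Re (G t) + - Im c * Im (G t))%R 0 (2 * PI)).
    + apply RInt_ext. intros t _. apply Re_mult.
    + rewrite L, Re_mult. reflexivity.
  - transitivity (RInt (fun t => Im c * Re (G t) + Re c * Im (G t))%R 0 (2 * PI)).
    + apply RInt_ext. intros t _. apply Im_mult.
    + rewrite L, Im_mult. reflexivity.
Qed.

Lemma cint_const (c : C) : cint (fun _ => c) = RtoC (2 * PI) * c.
Proof.
  apply C_eq; simpl; rewrite RInt_const; unfold scal; simpl; unfold mult, Re, Im; simpl; ring.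
Qed.

(** The constant is [4 * PI] instead of [2 * PI] because real and imaginary parts are bounded
    separately; the estimate only serves to make a remainder tend to 0. *)
Lemma cint_bound (G : R -> C) (B : R) : rcont G -> (forall t, Cmod (G t) <= B) ->
  Cmod (cint G) <= 4 * PI * B.
Proof.
  intros H HB. assert (HP := PI_RGT_0).
  destruct (rcont_ex_RInt G 0 (2 * PI) H) as [H1 H2].
  assert (K : forall u : R -> R, ex_RInt u 0 (2 * PI) -> (forall t, Rabs (u t) <= B) ->
    Rabs (RInt u 0 (2 * PI)) <= 2 * PI * B).
  { intros u Hu Hb.
    apply (norm_RInt_le (V := R_NormedModule) u (fun _ => B) 0 (2 * PI)).
    - lra.
    - intros t _. apply Hb.
    - apply (RInt_correct (V := R_CompleteNormedModule)). auto.
    - replace (2 * PI * B)%R with (scal (2 * PI - 0)%R B)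
        by (unfold scal; simpl; unfold mult; simpl; ring).
      apply (is_RInt_const (V := R_NormedModule)). }
  eapply Rle_trans; [apply Cmod_le_components|].
  assert (K1 : Rabs (Re (cint G)) <= 2 * PI * B).
  { apply K; auto. intros t. eapply Rle_trans; [apply re_le_Cmod|auto]. }
  assert (K2 : Rabs (Im (cint G)) <= 2 * PI * B).
  { apply K; auto. intros t. eapply Rle_trans; [apply im_le_Cmod|auto]. }
  lra.
Qed.

Lemma cint_deriv (P p : R -> C) :
  (forall t, rderiv P t (p t)) -> rcont p -> cint p = P (2 * PI)%R - P 0.
Proof.
  intros HP Hp. apply C_eq; apply (is_RInt_unique (V := R_CompleteNormedModule)).
  - apply (is_RInt_derive (V := R_CompleteNormedModule) (fun t => Re (P t)) (fun t => Re (p t))); intros t _.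
    + apply rderiv_Re, HP.
    + apply clim_Re, Hp.
  - apply (is_RInt_derive (V := R_CompleteNormedModule) (fun t => Im (P t)) (fun t => Im (p t))); intros t _.
    + apply rderiv_Im, HP.
    + apply clim_Im, Hp.
Qed.

(** [part] stands for [Re] or [Im]; the two properties asked of it let one proof serve both
    components. The joint continuity of [F'] at the points [(t, s)] is the condition for
    differentiating under the integral sign. *)
Lemma RInt_param_deriv (part : C -> R) (F F' : R -> R -> C) (t : R) :
  (forall p s l, rderiv p s l -> is_derive (fun u => part (p u)) s (part l)) ->
  (forall (T : UniformSpace) (x : T) (u : T -> C) l,
    clim (locally x) u l -> filterlim (fun y => part (u y)) (locally x) (locally (part l))) ->
  locally t (fun u => forall s, rderiv (fun v => F v s) u (F' u s)) ->
  locally t (fun u => rcont (F u)) ->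
  (forall s, clim (locally (t, s)) (fun p => F' (fst p) (snd p)) (F' t s)) ->
  is_derive (fun u => RInt (fun s => part (F u s)) 0 (2 * PI)) t
    (RInt (fun s => part (F' t s)) 0 (2 * PI)).
Proof.
  intros Hd Hc H1 H2 H3.
  assert (E : forall u, (forall s, rderiv (fun v => F v s) u (F' u s)) ->
    forall s, Derive (fun v => part (F v s)) u = part (F' u s)).
  { intros u Hu s. apply is_derive_unique, (Hd (fun v => F v s)), Hu. }
  rewrite (RInt_ext (fun s => part (F' t s)) (fun s => Derive (fun v => part (F v s)) t)).
  2:{ intros s _. symmetry. apply E. now apply locally_singleton in H1. }
  apply (is_derive_RInt_param (fun u s => part (F u s))).
  - generalize H1. apply filter_imp. intros u Hu s _. eexists.
    apply (Hd (fun v => F v s)), Hu.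
  - intros s _. apply continuity_2d_pt_ext_loc with (fun u v => part (F' u v)).
    + destruct H1 as [d H1]. exists d. intros u v Hu _. symmetry. apply E. now apply H1.
    + apply continuity_2d_pt_filterlim.
      apply (Hc _ (t, s) (fun p => F' (fst p) (snd p)) (F' t s)), H3.
  - generalize H2. apply filter_imp. intros u Hu.
    apply (ex_RInt_continuous (V := R_CompleteNormedModule)). intros s _.
    apply (Hc R_UniformSpace s (F u) (F u s)), Hu.
Qed.

Lemma cint_param (F F' : R -> R -> C) (t : R) :
  locally t (fun u => forall s, rderiv (fun v => F v s) u (F' u s)) ->
  locally t (fun u => rcont (F u)) ->
  (forall s, clim (locally (t, s)) (fun p => F' (fst p) (snd p)) (F' t s)) ->
  rderiv (fun u => cint (F u)) t (cint (F' t)).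
Proof.
  intros H1 H2 H3. apply rderiv_pair; apply RInt_param_deriv; auto.
  - apply rderiv_Re.
  - intros T x u l. apply clim_Re.
  - apply rderiv_Im.
  - intros T x u l. apply clim_Im.
Qed.

(** * The circle, Cauchy's kernel and its expansion *)

Definition circle (r t : R) : C := RtoC r * (cos t, sin t).

Lemma circle_Cmod (r t : R) : 0 < r -> Cmod (circle r t) = r.
Proof.
  intros Hr. unfold circle. rewrite Cmod_mult, Cmod_R, Rabs_right by lra.
  unfold Cmod. simpl. replace (cos t * (cos t * 1) + sin t * (sin t * 1))%R with 1%R.
  - rewrite sqrt_1. ring.
  - generalize (sin2_cos2 t). unfold Rsqr. lra.
Qed.

Lemma circle_neq0 (r t : R) : 0 < r -> circle r t <> 0.
Proof. intros Hr. apply Cmod_gt_0. now rewrite circle_Cmod. Qed.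

Lemma circle_minus_neq0 (r t : R) (z : C) : Cmod z < r -> circle r t - z <> 0.
Proof.
  intros Hz. apply Cmod_gt_0. generalize (Cmod_minus_triangle (circle r t) z) (Cmod_ge_0 z).
  intros H1 H2. rewrite circle_Cmod in H1; lra.
Qed.

Lemma circle_rderiv (r t : R) : rderiv (circle r) t (Ci * circle r t).
Proof.
  unfold circle. replace (Ci * (RtoC r * (cos t, sin t))) with (RtoC r * ((- sin t)%R, cos t)).
  - apply rderiv_scal_l, rderiv_pair; apply is_derive_Reals.
    + apply derivable_pt_lim_cos.
    + apply derivable_pt_lim_sin.
  - unfold Ci, RtoC, Cmult; simpl. f_equal; ring.
Qed.

Lemma circle_cont (r : R) : rcont (circle r).
Proof. intros t. eapply rderiv_clim, circle_rderiv. Qed.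

Lemma circle_period (r : R) : circle r (2 * PI) = circle r 0.
Proof. unfold circle. now rewrite cos_2PI, sin_2PI, cos_0, sin_0. Qed.

Lemma rcont_mult (G H : R -> C) : rcont G -> rcont H -> rcont (fun t => G t * H t).
Proof. intros HG HH t. now apply clim_mult. Qed.

Lemma rcont_inv_circle_pow (r : R) (n : nat) : 0 < r -> rcont (fun t => (/ circle r t) ^ n).
Proof.
  intros Hr t. apply clim_pow, clim_inv; [now apply circle_neq0|apply circle_cont].
Qed.

(** Cauchy's kernel in the angle: for zeta = [circle r t], the form d zeta / (zeta - z) equals i
    zeta / (zeta - z) dt, and the factor i is dropped. *)
Definition cauchy_ratio (r : R) (z : C) (t : R) : C := circle r t / (circle r t - z).

Lemma cauchy_ratio_cont (r : R) (z : C) : Cmod z < r -> rcont (cauchy_ratio r z).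
Proof.
  intros Hz t. apply clim_div.
  - now apply circle_minus_neq0.
  - apply circle_cont.
  - apply clim_minus; [apply circle_cont|apply clim_const].
Qed.

Lemma cauchy_ratio_bound (r t : R) (z : C) : Cmod z < r ->
  Cmod (cauchy_ratio r z t) <= r / (r - Cmod z).
Proof.
  intros Hz. assert (Hz0 := Cmod_ge_0 z). unfold cauchy_ratio.
  rewrite Cmod_div by now apply circle_minus_neq0. rewrite circle_Cmod by lra.
  apply Rmult_le_compat_l; [lra|]. apply Rinv_le_contravar; [lra|].
  generalize (Cmod_minus_triangle (circle r t) z). rewrite circle_Cmod; lra.
Qed.

(** The geometric series is run with its exact remainder, which avoids exchanging sum and integral.
    From zeta / (zeta - z) = 1 + (z / zeta) zeta / (zeta - z) comes [J n = c n + z * J (S n)], and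
    the remainder [z ^ n * J n] decays like (|z| / r)^n. *)
Lemma cauchy_ratio_pseries (G : R -> C) (B r : R) (z : C) :
  rcont G -> (forall t, Cmod (G t) <= B) -> Cmod z < r ->
  cpseries (fun n => cint (fun t => G t * (/ circle r t) ^ n)) z
    (cint (fun t => G t * cauchy_ratio r z t)).
Proof.
  intros HG HB Hz. assert (Hz0 := Cmod_ge_0 z). assert (Hr : 0 < r) by lra.
  set (c := fun n => cint (fun t => G t * (/ circle r t) ^ n)).
  set (J := fun n => cint (fun t => G t * (/ circle r t) ^ n * cauchy_ratio r z t)).
  assert (HcJ : forall n, rcont (fun t => G t * (/ circle r t) ^ n * cauchy_ratio r z t)).
  { intros n. apply (rcont_mult (fun t => G t * (/ circle r t) ^ n)).
    - apply rcont_mult; auto. now apply rcont_inv_circle_pow.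
    - now apply cauchy_ratio_cont. }
  assert (HJ : forall n, J n = c n + z * J (S n)).
  { intros n. unfold J, c. rewrite <- cint_scal by apply HcJ. rewrite <- cint_plus.
    - apply cint_ext. intros t. rewrite Cpow_S. unfold cauchy_ratio. field.
      split; [now apply circle_minus_neq0|now apply circle_neq0].
    - apply rcont_mult; auto. now apply rcont_inv_circle_pow.
    - intros t. apply clim_mult; [apply clim_const|apply HcJ]. }
  assert (HJ0 : forall N, J 0%nat = csum (fun n => z ^ n * c n) N + z ^ S N * J (S N)).
  { intros N. induction N as [|N IH].
    - rewrite csum_0, (HJ 0%nat). rewrite Cpow_S. change (z ^ 0) with (RtoC 1). ring.
    - rewrite csum_S, IH, (HJ (S N)), (Cpow_S z (S N)). ring. }
  set (K := (4 * PI * (B * (r / (r - Cmod z))))%R).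
  assert (HPI := PI_RGT_0).
  assert (HB0 : 0 <= B) by (eapply Rle_trans; [apply Cmod_ge_0|apply (HB 0)]).
  assert (Hrz : 0 <= r / (r - Cmod z)) by (apply Rdiv_le_0_compat; lra).
  assert (HK : 0 <= K).
  { unfold K. apply Rmult_le_pos; [lra|]. now apply Rmult_le_pos. }
  assert (HJb : forall n, Cmod (z ^ n * J n) <= K * (Cmod z / r) ^ n).
  { intros n. rewrite Cmod_mult, Cmod_pow.
    assert (HJn : Cmod (J n) <= 4 * PI * (B * (/ r) ^ n * (r / (r - Cmod z)))).
    { apply cint_bound; [apply HcJ|]. intros t. rewrite !Cmod_mult, Cmod_pow, Cmod_inv by
        now apply circle_neq0.
      rewrite circle_Cmod by auto.
      assert (0 <= (/ r) ^ n) by (apply pow_le; left; now apply Rinv_0_lt_compat).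
      apply Rmult_le_compat.
      - apply Rmult_le_pos; auto using Cmod_ge_0.
      - apply Cmod_ge_0.
      - apply Rmult_le_compat_r; auto.
      - now apply cauchy_ratio_bound. }
    eapply Rle_trans; [apply Rmult_le_compat_l; [apply pow_le, Cmod_ge_0|exact HJn]|].
    unfold Rdiv at 2. rewrite Rpow_mult_distr. unfold K. apply Req_le. ring. }
  apply cpseries_cseries, cseries_clim. intros eps Heps.
  assert (Hq : Rabs (Cmod z / r) < 1).
  { rewrite Rabs_right; [apply Rlt_div_l; lra|apply Rle_ge, Rdiv_le_0_compat; lra]. }
  destruct (pow_lt_1_zero (Cmod z / r) Hq (eps / (K + 1))) as [N HN].
  { apply Rdiv_lt_0_compat; lra. }
  exists N. intros n Hn.
  replace (cint (fun t => G t * cauchy_ratio r z t)) with (J 0%nat).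
  2:{ apply cint_ext. intros t. change ((/ circle r t) ^ 0) with (RtoC 1). ring. }
  rewrite (HJ0 n).
  replace (csum (fun n0 => z ^ n0 * c n0) n -
    (csum (fun n0 => z ^ n0 * c n0) n + z ^ S n * J (S n))) with (- (z ^ S n * J (S n))) by ring.
  rewrite Cmod_opp. eapply Rle_lt_trans; [apply HJb|].
  specialize (HN (S n) ltac:(lia)).
  assert (Hp : 0 <= (Cmod z / r) ^ S n) by (apply pow_le, Rdiv_le_0_compat; lra).
  rewrite Rabs_right in HN by lra.
  apply Rlt_div_r in HN; [|lra]. nra.
Qed.

(** Up to the nonzero factor -(n + 1) i, the integrand is its own angular derivative, and the circle
    closes up after one period. *)
Lemma cint_inv_circle_pow (r : R) (n : nat) : 0 < r ->
  cint (fun t => (/ circle r t) ^ S n) = 0.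
Proof.
  intros Hr.
  assert (HI : RtoC (INR (S n)) <> 0).
  { intros E. apply RtoC_inj in E. generalize (pos_INR n). rewrite S_INR in E. lra. }
  assert (Hd : forall t, rderiv (fun s => (/ circle r s) ^ S n) t
    (- RtoC (INR (S n)) * Ci * (/ circle r t) ^ S n)).
  { intros t. assert (H0 := circle_neq0 r t Hr).
    replace (- RtoC (INR (S n)) * Ci * (/ circle r t) ^ S n)
      with (dpow (S n) (/ circle r t) * (- / (circle r t * circle r t)) * (Ci * circle r t)).
    - apply (cderiv_rderiv (fun w => (/ w) ^ S n) (circle r)); [|apply circle_rderiv].
      apply (cderiv_comp (fun w => w ^ S n) Cinv); [apply cderiv_pow|now apply cderiv_inv].
    - unfold dpow. simpl pred. rewrite (Cpow_S (/ circle r t) n). field. auto. }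
  assert (Hc : rcont (fun t => (/ circle r t) ^ S n)) by now apply rcont_inv_circle_pow.
  assert (E : cint (fun t => - RtoC (INR (S n)) * Ci * (/ circle r t) ^ S n) = 0).
  { rewrite (cint_deriv _ _ Hd).
    - rewrite circle_period. ring.
    - intros t. apply clim_mult; [apply clim_const|apply Hc]. }
  rewrite cint_scal in E by exact Hc.
  replace (cint (fun t => (/ circle r t) ^ S n))
    with (/ (- RtoC (INR (S n)) * Ci) *
      (- RtoC (INR (S n)) * Ci * cint (fun t => (/ circle r t) ^ S n))).
  - rewrite E. ring.
  - field. split; [exact Ci_nz|exact HI].
Qed.

(** In the expansion for [G = 1] only the coefficient of degree 0 survives, so all partial sums
    equal [2 * PI]. *)
Lemma cint_cauchy_ratio (r : R) (z : C) : Cmod z < r ->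
  cint (cauchy_ratio r z) = RtoC (2 * PI).
Proof.
  intros Hz. assert (Hr : 0 < r) by (generalize (Cmod_ge_0 z); lra).
  assert (H := cauchy_ratio_pseries (fun _ => 1) 1 r z).
  rewrite (cint_ext _ (cauchy_ratio r z)) in H by (intros; ring).
  apply (clim_unique (F := eventually) _ (csum (fun n => z ^ n * cint (fun t => 1 * (/ circle r t) ^ n)))).
  - apply cseries_clim, H; auto.
    + intros t. apply clim_const.
    + intros t. rewrite Cmod_1. lra.
  - apply clim_ext with (fun _ => RtoC (2 * PI)); [|apply clim_const].
    apply filter_forall. intros n. induction n as [|n IH].
    + rewrite csum_0. rewrite (cint_ext _ (fun _ => 1)).
      * rewrite cint_const. change (z ^ 0) with (RtoC 1). ring.
      * intros t. change ((/ circle r t) ^ 0) with (RtoC 1). ring.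
    + rewrite csum_S, <- IH. rewrite (cint_ext _ (fun t => (/ circle r t) ^ S n)) by (intros; ring).
      rewrite cint_inv_circle_pow by auto. ring.
Qed.

(* The integral of f(z + t (zeta - z)) zeta / (zeta - z) over the circle does not depend
   on t: its t-derivative is, up to the factor i t, the integral of an angular derivative. *)
Lemma cauchy_formula (f f' : C -> C) (d r : R) (z : C) :
  (forall w, Cmod w < d -> cderiv f w (f' w) /\ ccont f' w) ->
  Cmod z < r -> r < d ->
  cint (fun t => f (circle r t) * cauchy_ratio r z t) = RtoC (2 * PI) * f z.
Proof.
  intros Hf Hz Hrd. assert (Hz0 := Cmod_ge_0 z). assert (Hr : 0 < r) by lra.
  set (pt := fun t s => z + RtoC t * (circle r s - z)).
  assert (Hpt : forall t, 0 <= t <= 1 ->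
    locally t (fun u => forall s, Cmod (pt u s) < d)).
  (* Since |zeta - z| <= 2 r on the circle, changing [t] by less than (d - r) / (2 r) moves the
     point by less than d - r, uniformly in the angle. *)
  { intros t Ht. assert (He : 0 < (d - r) / (2 * r)) by (apply Rdiv_lt_0_compat; lra).
    exists (mkposreal _ He). intros u Hu s. change (Rabs (u - t) < (d - r) / (2 * r)) in Hu.
    replace (pt u s) with (RtoC (1 - t) * z + (RtoC t * circle r s + RtoC (u - t) * (circle r s - z)))
      by (unfold pt; rewrite !RtoC_minus; ring).
    eapply Rle_lt_trans; [apply Cmod_triangle|].
    eapply Rle_lt_trans; [apply Rplus_le_compat_l, Cmod_triangle|].
    rewrite !Cmod_mult, !Cmod_R, (Rabs_right t), (Rabs_right (1 - t)), circle_Cmod by lra.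
    assert (Hcz : Cmod (circle r s - z) <= 2 * r).
    { eapply Rle_trans; [apply Cmod_triangle|]. rewrite Cmod_opp, circle_Cmod; lra. }
    apply Rlt_div_r in Hu; [|lra].
    assert (Rabs (u - t) * Cmod (circle r s - z) <= Rabs (u - t) * (2 * r)).
    { apply Rmult_le_compat_l; [apply Rabs_pos|auto]. }
    nra. }
  set (F := fun t s => f (pt t s) * cauchy_ratio r z s).
  (* The inner derivative [circle r s - z] has cancelled the denominator of the kernel. *)
  set (F' := fun t s => f' (pt t s) * circle r s).
  assert (Hpt2 : forall t s, clim (locally (t, s)) (fun p : R * R => pt (fst p) (snd p)) (pt t s)).
  { intros t s. unfold pt. apply clim_plus; [apply clim_const|]. apply clim_mult.
    - apply (clim_pair (fun p : R * R => fst p) (fun _ => 0%R)).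
      + apply continuous_fst.
      + apply filterlim_const.
    - apply clim_minus; [|apply clim_const].
      apply clim_snd, circle_cont. }
  assert (Hpts : forall t, rcont (pt t)).
  { intros t s. unfold pt. apply clim_plus; [apply clim_const|]. apply clim_mult; [apply clim_const|].
    apply clim_minus; [apply circle_cont|apply clim_const]. }
  assert (Hder : forall t, 0 <= t <= 1 -> rderiv (fun u => cint (F u)) t (cint (F' t))).
  { intros t Ht. apply cint_param.
    - generalize (Hpt t Ht). apply filter_imp. intros u Hu s. unfold F, F'.
      replace (f' (pt u s) * circle r s) with (cauchy_ratio r z s * (f' (pt u s) * (circle r s - z))).
      2:{ unfold cauchy_ratio. field. now apply circle_minus_neq0. }
      destruct (rderiv_scal_l (cauchy_ratio r z s) (fun v => f (pt v s)) u
        (f' (pt u s) * (circle r s - z))) as [q Hq].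
      + apply (cderiv_rderiv f (fun v => pt v s)); [now apply Hf|].
        unfold pt. apply rderiv_affine.
      + exists q. destruct Hq as [Hq1 Hq2]. split; auto. intros v.
        rewrite (Cmult_comm (f (pt v s))), (Cmult_comm (f (pt u s))). apply Hq1.
    - generalize (Hpt t Ht). apply filter_imp. intros u Hu. apply rcont_mult.
      + intros s. apply clim_comp; [apply Hpts|]. apply cderiv_cont with (f' (pt u s)).
        now apply Hf.
      + now apply cauchy_ratio_cont.
    - intros s. unfold F'. apply clim_mult.
      + apply clim_comp; [apply Hpt2|]. apply Hf. apply (locally_singleton _ _ (Hpt t Ht)).
      + apply clim_snd, circle_cont. }
  (* The argument divides by [t], which excludes [t = 0]; the mean value theorem needs the
     derivative only on the open interval. *)
  assert (Hzero : forall t, 0 < t < 1 -> cint (F' t) = 0).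
  { intros t Ht. assert (Ht' : 0 <= t <= 1) by lra.
    assert (Hin := locally_singleton _ _ (Hpt t Ht')). cbv beta in Hin.
    assert (Hc : rcont (F' t)).
    { apply rcont_mult; [|apply circle_cont]. intros s. apply clim_comp; [apply Hpts|].
      now apply Hf. }
    assert (E : cint (fun s => RtoC t * Ci * F' t s) = 0).
    { rewrite (cint_deriv (fun s => f (pt t s))).
      - unfold pt. rewrite circle_period. ring.
      - intros s. replace (RtoC t * Ci * F' t s) with (f' (pt t s) * (RtoC t * (Ci * circle r s)))
          by (unfold F'; ring).
        apply (cderiv_rderiv f (pt t)); [now apply Hf|].
        unfold pt. apply rderiv_shift, rderiv_scal_l.
        destruct (rderiv_shift (- z) _ _ _ (circle_rderiv r s)) as [q [Hq1 Hq2]].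
        exists q. split; auto. intros v. generalize (Hq1 v). intros Hv.
        replace (circle r v - z) with (- z + circle r v) by ring. rewrite Hv. ring.
      - intros s. apply clim_mult; [apply clim_const|apply Hc]. }
    rewrite cint_scal in E by exact Hc.
    assert (Ht0 : RtoC t <> 0) by (intros E0; apply RtoC_inj in E0; lra).
    replace (cint (F' t)) with (/ (RtoC t * Ci) * (RtoC t * Ci * cint (F' t))).
    - rewrite E. ring.
    - field. split; [exact Ci_nz|auto]. }
  assert (E : cint (F 1) = cint (F 0)).
  { apply C_eq.
    - destruct (MVT_gen (fun u => Re (cint (F u))) 0 1 (fun _ => 0%R)) as [x [_ E]].
      + rewrite Rmin_left, Rmax_right by lra. intros x Hx.
        replace 0%R with (Re (cint (F' x))) by (rewrite Hzero by auto; reflexivity).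
        apply (rderiv_Re (fun u => cint (F u))), Hder. lra.
      + rewrite Rmin_left, Rmax_right by lra. intros x Hx.
        eapply is_derive_continuity_pt, (rderiv_Re (fun u => cint (F u))), Hder. lra.
      + cbv beta in E. lra.
    - destruct (MVT_gen (fun u => Im (cint (F u))) 0 1 (fun _ => 0%R)) as [x [_ E]].
      + rewrite Rmin_left, Rmax_right by lra. intros x Hx.
        replace 0%R with (Im (cint (F' x))) by (rewrite Hzero by auto; reflexivity).
        apply (rderiv_Im (fun u => cint (F u))), Hder. lra.
      + rewrite Rmin_left, Rmax_right by lra. intros x Hx.
        eapply is_derive_continuity_pt, (rderiv_Im (fun u => cint (F u))), Hder. lra.
      + cbv beta in E. lra. }
  rewrite <- (cint_cauchy_ratio r z Hz), Cmult_comm.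
  rewrite <- cint_scal by now apply cauchy_ratio_cont.
  transitivity (cint (F 1)); [|rewrite E]; apply cint_ext; intros s; unfold F, pt.
  - replace (z + RtoC 1 * (circle r s - z)) with (circle r s) by ring. reflexivity.
  - replace (z + RtoC 0 * (circle r s - z)) with z by ring. reflexivity.
Qed.

(** Together with [analytic0_hol], this makes analytic germs stable under every operation proved for
    [hol]: quotients, composition, and later logarithms, roots and implicit solutions. *)
Lemma hol_analytic0 (f : C -> C) : hol 0 f -> analytic0 f.
Proof.
  intros Hh. assert (Hc := hol_cont _ _ Hh). destruct Hh as [f' Hf].
  (* Continuity at 0 with tolerance 1 bounds [f] by [1 + Cmod (f 0)] on a small disc, so no
     compactness argument on the circle is needed. *)
  assert (Hb := Hc 1%R ltac:(lra)).
  destruct (proj1 (nbhd_iff _ _) (filter_and _ _ Hf Hb)) as [d [Hd H]].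
  set (r := (d / 2)%R).
  assert (HPI : RtoC (2 * PI) <> 0).
  { intros E. apply RtoC_inj in E. generalize PI_RGT_0. lra. }
  exists (fun n => / RtoC (2 * PI) * cint (fun t => f (circle r t) * (/ circle r t) ^ n)).
  apply nbhd_iff. exists r. split; [unfold r; lra|]. intros z Hz. rewrite Cminus_0_r in Hz.
  assert (Hcirc : forall t, Cmod (circle r t - 0) < d).
  { intros t. rewrite Cminus_0_r, circle_Cmod; unfold r; lra. }
  replace (f z) with (/ RtoC (2 * PI) * cint (fun t => f (circle r t) * cauchy_ratio r z t)).
  - apply cpseries_cseries.
    apply cseries_ext with (fun n => / RtoC (2 * PI) *
      (z ^ n * cint (fun t => f (circle r t) * (/ circle r t) ^ n))); [intros n; ring|].
    apply cseries_scal.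
    apply (cauchy_ratio_pseries (fun t => f (circle r t)) (1 + Cmod (f 0))); auto.
    + intros t. apply clim_comp; [apply circle_cont|].
      eapply cderiv_cont. apply (H _ (Hcirc t)).
    + intros t. destruct (H _ (Hcirc t)) as [_ Hbt].
      generalize (Cmod_minus_triangle (f (circle r t)) (f 0)). lra.
  - rewrite (cauchy_formula f f' d r z); auto.
    + field. auto.
    + intros w Hw. apply H. now rewrite Cminus_0_r.
    + unfold r. lra.
Qed.

(** * Exponential, logarithm and roots *)

Lemma Cexp_plus (a b : C) : Cexp (a + b) = Cexp a * Cexp b.
Proof.
  unfold Cexp. change (Re (a + b)) with (Re a + Re b)%R.
  change (Im (a + b)) with (Im a + Im b)%R. rewrite exp_plus, cos_plus, sin_plus.
  unfold Cmult; simpl. f_equal; ring.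
Qed.

Lemma Cexp_0 : Cexp 0 = 1.
Proof.
  unfold Cexp. change (Re 0) with 0%R. change (Im 0) with 0%R.
  rewrite exp_0, cos_0, sin_0. unfold RtoC. f_equal; ring.
Qed.

Lemma Cexp_neq0 (a : C) : Cexp a <> 0.
Proof.
  intros E. assert (H : Cexp a * Cexp (- a) = 1).
  { rewrite <- Cexp_plus. replace (a + - a) with (RtoC 0) by ring. apply Cexp_0. }
  rewrite E, Cmult_0_l in H. apply C1_nz. now symmetry.
Qed.

Lemma Cexp_nat (a : C) (n : nat) : Cexp a ^ n = Cexp (RtoC (INR n) * a).
Proof.
  induction n as [|n IH].
  - simpl INR. rewrite Cmult_0_l, Cexp_0. reflexivity.
  - rewrite Cpow_S, IH, <- Cexp_plus, S_INR, RtoC_plus. f_equal. ring.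
Qed.

Lemma clim_Re_component (z : C) : clim (nbhd z) (fun w => RtoC (Re w)) (RtoC (Re z)).
Proof.
  apply (clim_pair (fun w : C => Re w) (fun _ => 0%R)).
  - apply clim_Re, clim_id.
  - apply filterlim_const.
Qed.

Lemma clim_Im_component (z : C) : clim (nbhd z) (fun w => RtoC (Im w)) (RtoC (Im z)).
Proof.
  apply (clim_pair (fun w : C => Im w) (fun _ => 0%R)).
  - apply clim_Im, clim_id.
  - apply filterlim_const.
Qed.

(** Also valid at [w = 0], where the hypothesis forces [x = 0]; the bound is thus available for
    every [w]. *)
Lemma Cmod_part_ratio (x : R) (w : C) : Rabs x <= Cmod w -> Cmod (RtoC x / w) <= 1.
Proof.
  intros H. destruct (Ceq_dec w 0) as [->|Hn].
  - rewrite Cmod_0 in H. assert (x = 0%R) as ->.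
    { generalize (Rabs_pos x). intros H1. destruct (Req_dec x 0) as [|Hx]; auto.
      apply Rabs_no_R0 in Hx. lra. }
    unfold Cdiv. rewrite Cmult_0_l, Cmod_0. lra.
  - rewrite Cmod_div, Cmod_R by auto. apply Cmod_gt_0 in Hn.
    apply Rle_div_l; lra.
Qed.

Lemma clim_zero_bounded {T} (F : (T -> Prop) -> Prop) {FF : Filter F} (u v : T -> C) :
  clim F u 0 -> (forall x, Cmod (v x) <= 1) -> clim F (fun x => u x * v x) 0.
Proof.
  intros Hu Hv. apply clim_squeeze0 with u; auto. apply filter_forall. intros x.
  rewrite Cmod_mult. generalize (Cmod_ge_0 (u x)) (Cmod_ge_0 (v x)) (Hv x). nra.
Qed.

(** For w = x + i y, write e^x = 1 + p x and e^(iy) = 1 + s y. The slope is p x/w + s y/w + p s x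
    y/w; subtracting 1 = x/w + i y/w leaves [u], in which factors tending to 0 multiply the bounded
    ratios x/w and y/w. *)
Lemma cderiv_Cexp_0 : cderiv Cexp 0 1.
Proof.
  assert (H1 : rderiv (fun t => (exp t, 0%R) : C) 0 (1, 0%R)).
  { apply rderiv_pair.
    - apply is_derive_Reals, derivable_pt_lim_exp_0.
    - apply (@is_derive_const R_AbsRing R_NormedModule). }
  assert (H2 : rderiv (fun t => (cos t, sin t) : C) 0 ((- sin 0)%R, cos 0)).
  { apply rderiv_pair; apply is_derive_Reals.
    - apply derivable_pt_lim_cos.
    - apply derivable_pt_lim_sin. }
  rewrite sin_0, cos_0, Ropp_0 in H2.
  change (rderiv (fun t => (exp t, 0%R) : C) 0 1) in H1.
  change (rderiv (fun t => (cos t, sin t) : C) 0 Ci) in H2.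
  destruct H1 as [p [Ep [_ Hp]]], H2 as [s [Es [_ Hs]]].
  set (u := fun w : C => (p (Re w) - 1) * (RtoC (Re w) / w) + (s (Im w) - Ci) * (RtoC (Im w) / w)
     + p (Re w) * s (Im w) * RtoC (Re w) * (RtoC (Im w) / w)).
  apply cderiv_of_quotient with (fun w => 1 + u w).
  - apply filter_forall. intros w Hw. rewrite Cexp_0, Cminus_0_r. unfold u.
    assert (E : Cexp w = (exp (Re w), 0%R) * (cos (Im w), sin (Im w))).
    { unfold Cexp, Cmult; simpl. f_equal; ring. }
    rewrite E, (Ep (Re w)), (Es (Im w)), exp_0, cos_0, sin_0, !Rminus_0_r.
    change (1%R, 0%R) with (RtoC 1).
    field_simplify; auto.
    assert (Ew : w = RtoC (Re w) + Ci * RtoC (Im w)).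
    { destruct w as [x y]. unfold Ci, RtoC, Cplus, Cmult; simpl. f_equal; ring. }
    revert Ew. generalize (p (Re w)) (s (Im w)) (RtoC (Re w)) (RtoC (Im w)).
    intros P S X Y Ew. rewrite Ew. ring.
  - unfold u. change (Re 0) with 0%R. change (Im 0) with 0%R. unfold Cdiv. ring.
  - apply ccont_intro with (RtoC 1).
    2:{ unfold u. change (Re 0) with 0%R. change (Im 0) with 0%R. unfold Cdiv. ring. }
    assert (HpR : clim (nbhd (RtoC 0)) (fun w => p (Re w)) 1).
    { intros eps Heps. exact (clim_Re _ _ (clim_id (RtoC 0)) _ (Hp eps Heps)). }
    assert (HsI : clim (nbhd (RtoC 0)) (fun w => s (Im w)) Ci).
    { intros eps Heps. exact (clim_Im _ _ (clim_id (RtoC 0)) _ (Hs eps Heps)). }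
    assert (HR1 : forall w : C, Cmod (RtoC (Re w) / w) <= 1).
    { intros w. apply Cmod_part_ratio, re_le_Cmod. }
    assert (HI1 : forall w : C, Cmod (RtoC (Im w) / w) <= 1).
    { intros w. apply Cmod_part_ratio, im_le_Cmod. }
    apply clim_eq with (1 + (0 + 0 + 0)); [|ring].
    apply clim_plus; [apply clim_const|]. apply clim_plus; [apply clim_plus|];
      apply (clim_zero_bounded (nbhd (RtoC 0))); auto.
    + apply clim_eq with (RtoC 1 - 1); [|ring]. apply clim_minus; auto. apply clim_const.
    + apply clim_eq with (Ci - Ci); [|ring]. apply clim_minus; auto. apply clim_const.
    + apply clim_eq with (1 * Ci * RtoC (Re 0)).
      * repeat apply clim_mult; auto. apply clim_Re_component.
      * change (Re 0) with 0%R. ring.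
Qed.

Lemma cderiv_Cexp (z : C) : cderiv Cexp z (Cexp z).
Proof.
  apply cderiv_ext with (fun w => Cexp z * Cexp (w - z)).
  { apply filter_forall. intros w. rewrite <- Cexp_plus. f_equal. ring. }
  assert (E : 0 * Cexp (z - z) + Cexp z * (1 * (1 + 0)) = Cexp z) by ring.
  refine (eq_ind _ (cderiv _ z) _ _ E).
  apply (cderiv_mult (fun _ => Cexp z) (fun w => Cexp (w - z)) z 0 (1 * (1 + 0))); [apply cderiv_const|]. apply (cderiv_comp Cexp (fun w => w - z)).
  - replace (z - z) with (RtoC 0) by ring. apply cderiv_Cexp_0.
  - apply cderiv_plus; [apply cderiv_id|apply cderiv_const].
Qed.

Lemma hol_Cexp (z : C) : hol z Cexp.
Proof.
  exists Cexp. apply filter_forall. intros w. split; [apply cderiv_Cexp|].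
  eapply cderiv_cont, cderiv_Cexp.
Qed.

(** Identities between logarithms are proved through this: equality after exponentiation and a bound
    on the imaginary parts. For y = Im (a - b), the half angle turns cos y = 1 into sin (y/2) = 0
    with |y/2| < PI. *)
Lemma Cexp_inj (a b : C) : Cexp a = Cexp b -> Rabs (Im a - Im b) < 2 * PI -> a = b.
Proof.
  intros E Hlt. set (d := a - b).
  assert (Ed : Cexp d = 1).
  { assert (K : Cexp b * Cexp d = Cexp b * 1).
    { rewrite <- Cexp_plus, <- E, Cmult_1_r. f_equal. unfold d. ring. }
    replace (Cexp d) with (/ Cexp b * (Cexp b * Cexp d)) by (field; apply Cexp_neq0).
    rewrite K. field. apply Cexp_neq0. }
  change (Rabs (Im d) < 2 * PI) in Hlt.
  assert (E1 : (exp (Re d) * cos (Im d) = 1)%R) by exact (f_equal Re Ed).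
  assert (E2 : (exp (Re d) * sin (Im d) = 0)%R) by exact (f_equal Im Ed).
  assert (Hx := exp_pos (Re d)).
  assert (Hsin : sin (Im d) = 0%R).
  { apply Rmult_integral in E2. destruct E2; lra. }
  assert (Hcos : cos (Im d) = 1%R).
  { assert (Hc := sin2_cos2 (Im d)). rewrite Hsin in Hc. unfold Rsqr in Hc. nra. }
  assert (Hre : Re d = 0%R).
  { rewrite Hcos, Rmult_1_r, <- exp_0 in E1. now apply exp_inv. }
  assert (Him : Im d = 0%R).
  { assert (Hh : sin (Im d / 2) = 0%R).
    { assert (H2 := cos_2a_sin (Im d / 2)). replace (2 * (Im d / 2))%R with (Im d) in H2 by field.
      rewrite Hcos in H2. nra. }
    apply Rabs_def2 in Hlt. destruct (Rtotal_order (Im d) 0) as [Hn|[H0|Hp]]; auto.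
    - assert (0 < sin (- (Im d / 2))) by (apply sin_gt_0; lra). rewrite sin_neg in *. lra.
    - assert (0 < sin (Im d / 2)) by (apply sin_gt_0; lra). lra. }
  assert (Hd : d = 0) by (apply C_eq; auto).
  replace a with (d + b) by (unfold d; ring). rewrite Hd. ring.
Qed.

(** [acos] only yields the nonnegative sine |Im z| / |z|; the sign test in [Carg] restores the
    sign. *)
Lemma Carg_cos_sin (z : C) : z <> 0 ->
  cos (Carg z) = (Re z / Cmod z)%R /\ sin (Carg z) = (Im z / Cmod z)%R.
Proof.
  intros Hz. assert (Hm := proj1 (Cmod_gt_0 z) Hz).
  assert (HR := re_le_Cmod z). apply Rabs_le_between in HR.
  assert (Hu : -1 <= Re z / Cmod z <= 1).
  { split; [apply Rle_div_r; lra|apply Rle_div_l; lra]. }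
  assert (HS : sin (acos (Re z / Cmod z)) = (Rabs (Im z) / Cmod z)%R).
  { rewrite sin_acos by auto.
    replace (1 - (Re z / Cmod z)²)%R with ((Rabs (Im z) / Cmod z)²)%R.
    - apply sqrt_Rsqr. apply Rdiv_le_0_compat; [apply Rabs_pos|auto].
    - rewrite !Rsqr_div', <- Rsqr_abs. generalize (Cmod2_alt z). unfold Rsqr. intros E.
      assert (E' : (Im z * Im z = Cmod z * Cmod z - Re z * Re z)%R) by (simpl in E; lra).
      rewrite E'. field. lra. }
  unfold Carg. destruct (Rle_dec 0 (Im z)) as [Hi|Hi].
  - rewrite cos_acos by auto. split; auto. rewrite HS, Rabs_right; lra.
  - rewrite cos_neg, sin_neg, cos_acos by auto. split; auto.
    rewrite HS, Rabs_left by lra. unfold Rdiv. ring.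
Qed.

Lemma Cexp_Clog (z : C) : z <> 0 -> Cexp (Clog z) = z.
Proof.
  intros Hz. assert (Hm := proj1 (Cmod_gt_0 z) Hz).
  destruct (Carg_cos_sin z Hz) as [Hc Hs]. unfold Cexp, Clog. cbn [Re Im fst snd].
  rewrite exp_ln, Hc, Hs by auto.
  apply C_eq; simpl; field; lra.
Qed.

Lemma Re_pos_neq0 (z : C) : 0 < Re z -> z <> 0.
Proof. intros H ->. simpl in H. lra. Qed.

(** A positive cosine confines the argument to (-PI/2, PI/2), away from the cut, where it is an
    arctangent; in this form its continuity is visible. *)
Lemma Im_Clog (z : C) : 0 < Re z ->
  - (PI / 2) < Im (Clog z) < PI / 2 /\ Im (Clog z) = atan (Im z / Re z).
Proof.
  intros Hz. assert (Hz0 := Re_pos_neq0 z Hz). assert (Hm := proj1 (Cmod_gt_0 z) Hz0).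
  destruct (Carg_cos_sin z Hz0) as [Hc Hs]. cbn [Clog Im snd].
  assert (HB : - (PI / 2) < Carg z < PI / 2).
  { assert (Hpos : 0 < cos (Carg z)) by (rewrite Hc; now apply Rdiv_lt_0_compat).
    assert (HPI := PI_RGT_0).
    assert (HR : - PI <= Carg z <= PI).
    { unfold Carg. generalize (acos_bound (Re z / Cmod z)).
      destruct (Rle_dec 0 (Im z)); lra. }
    split; apply Rnot_le_lt; intros Hle.
    - rewrite <- cos_neg in Hpos. assert (cos (- Carg z) <= 0) by (apply cos_le_0; lra). lra.
    - assert (cos (Carg z) <= 0) by (apply cos_le_0; lra). lra. }
  split; auto. rewrite <- (atan_tan (Carg z)) by lra. f_equal. unfold tan.
  rewrite Hc, Hs. field. lra.
Qed.

Lemma nbhd_Re_pos (z : C) : 0 < Re z -> nbhd z (fun w => 0 < Re w).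
Proof.
  intros Hz. apply nbhd_iff. exists (Re z). split; auto. intros w Hw.
  generalize (re_le_Cmod (w - z)). change (Re (w - z)) with (Re w - Re z)%R. intros H.
  assert (H' : Rabs (Re w - Re z) < Re z) by lra. apply Rabs_def2 in H'. lra.
Qed.

Lemma Clog_cont (z : C) : 0 < Re z -> ccont Clog z.
Proof.
  intros Hz. assert (Hz0 := Re_pos_neq0 z Hz). assert (Hm := proj1 (Cmod_gt_0 z) Hz0).
  assert (HRe : RtoC (Re z) <> 0) by (intros E; apply RtoC_inj in E; lra).
  (* The real quotient of [Im w] by [Re w] is written as the real part of a complex quotient so that
     [clim_div] applies. *)
  apply clim_ext with (fun w => (ln (Cmod w), atan (Re (RtoC (Im w) / RtoC (Re w))))).
  { generalize (nbhd_Re_pos z Hz). apply filter_imp. intros w Hw. apply C_eq; auto.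
    cbn [Re Im fst snd]. rewrite (proj2 (Im_Clog w Hw)), <- RtoC_div by lra. reflexivity. }
  apply clim_eq with (ln (Cmod z), atan (Re (RtoC (Im z) / RtoC (Re z)))).
  2:{ apply C_eq; auto. cbn [Re Im fst snd].
      rewrite (proj2 (Im_Clog z Hz)), <- RtoC_div by lra. reflexivity. }
  apply clim_pair.
  - apply (filterlim_comp _ _ _ (fun w : C => Cmod w) ln _ (locally (Cmod z))).
    + intros P [d HP]. apply nbhd_iff. exists d. split; [apply cond_pos|]. intros w Hw.
      apply HP. change (Rabs (Cmod w - Cmod z) < d). eapply Rle_lt_trans; [|exact Hw].
      apply Rabs_le. generalize (Cmod_minus_triangle w z) (Cmod_minus_triangle z w).
      rewrite (Cmod_minus_sym z w). lra.
    + apply continuity_pt_filterlim, is_derive_continuity_pt with (/ Cmod z)%R.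
      apply is_derive_Reals, derivable_pt_lim_ln. auto.
  - apply (filterlim_comp _ _ _ (fun w : C => Re (RtoC (Im w) / RtoC (Re w))) atan _
      (locally (Re (RtoC (Im z) / RtoC (Re z))))).
    + apply clim_Re, clim_div; auto using clim_Re_component, clim_Im_component.
    + apply continuity_pt_filterlim, derivable_continuous_pt, derivable_pt_atan.
Qed.

(** As [Cexp] undoes [Clog], the slope of the logarithm between [z] and [w] is the inverse of the
    slope of [Cexp] between [Clog z] and [Clog w]; continuity of [Clog] lets [w] tend to [z]. *)
Lemma cderiv_Clog (z : C) : 0 < Re z -> cderiv Clog z (/ z).
Proof.
  intros Hz. assert (Hz0 := Re_pos_neq0 z Hz).
  destruct (cderiv_Cexp (Clog z)) as [q [E [Hq Hcq]]].
  rewrite Cexp_Clog in E, Hq by auto.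
  assert (Hl : clim (nbhd z) (fun w => q (Clog w)) z).
  { apply clim_eq with (q (Clog z)); auto. apply clim_comp; auto. now apply Clog_cont. }
  apply cderiv_of_quotient with (fun w => / q (Clog w)).
  - generalize (filter_and _ _ (clim_neq0 _ _ Hz0 (clim_id z)) (clim_neq0 _ _ Hz0 Hl)).
    apply filter_imp. intros w [H1 H2] _.
    assert (Ew := E (Clog w)). rewrite Cexp_Clog in Ew by auto.
    replace (w - z) with (q (Clog w) * (Clog w - Clog z)) by (rewrite Ew at 3; ring).
    field. auto.
  - now rewrite Hq.
  - apply ccont_intro with (/ z); [|now rewrite Hq]. now apply clim_inv.
Qed.

Lemma hol_Clog (z : C) : 0 < Re z -> hol z Clog.
Proof.
  intros Hz. exists Cinv. generalize (nbhd_Re_pos z Hz). apply filter_imp. intros w Hw.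
  split; [now apply cderiv_Clog|]. apply clim_inv; [now apply Re_pos_neq0|apply clim_id].
Qed.

Lemma Clog_Cexp (a : C) : - (PI / 2) < Im a < PI / 2 -> Clog (Cexp a) = a.
Proof.
  intros Ha. assert (HPI := PI_RGT_0). apply Cexp_inj.
  - apply Cexp_Clog, Cexp_neq0.
  - assert (H : 0 < Re (Cexp a)).
    { simpl. apply Rmult_lt_0_compat; [apply exp_pos|]. apply cos_gt_0; lra. }
    destruct (Im_Clog _ H) as [HB _]. apply Rabs_def1; lra.
Qed.

Lemma Clog_1 : Clog 1 = 0.
Proof.
  rewrite <- Cexp_0. apply Clog_Cexp. simpl. generalize PI_RGT_0. lra.
Qed.

(** Each of the three imaginary parts lies in (-PI/2, PI/2), so those of the two sides differ by
    less than 3 PI / 2, which excludes a jump of 2 PI. *)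
Lemma Clog_mult (a b : C) : 0 < Re a -> 0 < Re b -> 0 < Re (a * b) ->
  Clog (a * b) = Clog a + Clog b.
Proof.
  intros Ha Hb Hab. assert (HPI := PI_RGT_0). apply Cexp_inj.
  - rewrite Cexp_plus, !Cexp_Clog; auto using Re_pos_neq0.
  - destruct (Im_Clog _ Ha) as [HA _], (Im_Clog _ Hb) as [HB _], (Im_Clog _ Hab) as [HC _].
    change (Im (Clog a + Clog b)) with (Im (Clog a) + Im (Clog b))%R. apply Rabs_def1; lra.
Qed.

Lemma INR_S_neq0 (n : nat) : RtoC (INR (S n)) <> 0.
Proof.
  intros E. apply RtoC_inj in E. generalize (pos_INR n). rewrite S_INR in E. lra.
Qed.

Lemma Croot_pow (n : nat) (y : C) : y <> 0 -> Croot (S n) y ^ S n = y.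
Proof.
  intros Hy. unfold Croot. rewrite Cexp_nat.
  replace (RtoC (INR (S n)) * (Clog y / RtoC (INR (S n)))) with (Clog y).
  - now apply Cexp_Clog.
  - field. apply INR_S_neq0.
Qed.

(** Unlike [Croot_pow], this is local: [S n] times [Clog x] must stay in the strip where [Clog]
    inverts [Cexp], as it does near 1. *)
Lemma pow_Croot (n : nat) : nbhd (RtoC 1) (fun x => Croot (S n) (x ^ S n) = x).
Proof.
  assert (H1 : 0 < Re 1) by (simpl; lra).
  assert (Hl : clim (nbhd (RtoC 1)) (fun x => RtoC (INR (S n)) * Clog x) 0).
  { apply clim_eq with (RtoC (INR (S n)) * Clog 1).
    - apply clim_mult; [apply clim_const|]. now apply Clog_cont.
    - rewrite Clog_1. ring. }
  assert (HPI : 0 < PI / 2) by (generalize PI_RGT_0; lra).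
  generalize (filter_and _ _ (nbhd_Re_pos (RtoC 1) H1) (Hl _ HPI)). apply filter_imp.
  intros x [Hx Hx2]. rewrite Cminus_0_r in Hx2.
  assert (E : x = Cexp (Clog x)) by (symmetry; apply Cexp_Clog, Re_pos_neq0; auto).
  unfold Croot. rewrite E at 1. rewrite Cexp_nat, Clog_Cexp.
  - replace (RtoC (INR (S n)) * Clog x / RtoC (INR (S n))) with (Clog x); auto.
    field. apply INR_S_neq0.
  - assert (H := im_le_Cmod (RtoC (INR (S n)) * Clog x)).
    assert (H' : Rabs (Im (RtoC (INR (S n)) * Clog x)) < PI / 2) by lra.
    apply Rabs_def2 in H'. lra.
Qed.

Lemma Croot_1 (n : nat) : Croot n 1 = 1.
Proof. unfold Croot. rewrite Clog_1. unfold Cdiv. rewrite Cmult_0_l. apply Cexp_0. Qed.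

Lemma hol_Croot (n : nat) (z : C) : 0 < Re z -> hol z (Croot n).
Proof.
  intros Hz. apply (hol_comp z Cexp); [apply hol_Cexp|].
  apply hol_mult; [now apply hol_Clog|apply hol_const].
Qed.

(** * Implicit and inverse germs *)

Lemma cderiv_unique (f : C -> C) (z a b : C) : cderiv f z a -> cderiv f z b -> a = b.
Proof.
  intros [p [E1 [H1 K1]]] [q [E2 [H2 K2]]]. subst a b.
  destruct (Ceq_dec (p z) (q z)) as [|Hn]; auto. exfalso.
  assert (He : p z - q z <> 0) by now apply Cminus_eq_contra.
  assert (Hc : clim (nbhd z) (fun w => p w - q w) (p z - q z)) by now apply clim_minus.
  assert (Hne := clim_neq0 _ _ He Hc). apply nbhd_iff in Hne. destruct Hne as [d [Hd H]].
  assert (Hw : RtoC (d / 2) <> 0) by (intros E; apply RtoC_inj in E; lra).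
  apply (H (z + RtoC (d / 2))).
  - replace (z + RtoC (d / 2) - z) with (RtoC (d / 2)) by ring.
    rewrite Cmod_R, Rabs_right; lra.
  - assert (E3 := E1 (z + RtoC (d / 2))). rewrite (E2 (z + RtoC (d / 2))) in E3.
    replace (z + RtoC (d / 2) - z) with (RtoC (d / 2)) in E3 by ring.
    set (w := z + RtoC (d / 2)) in *.
    replace (p w - q w) with ((f z + p w * RtoC (d / 2) - (f z + q w * RtoC (d / 2))) / RtoC (d / 2))
      by (field; auto).
    rewrite E3. unfold Cdiv. ring.
Qed.

(** Picard iteration from 0. The bound on [T 0] keeps the iterates in the disc, and completeness
    enters through the telescoping series of increments, dominated by [rho / 2 * (1 / 2) ^ n]. *)
Lemma contraction_fixpoint (T : C -> C) (rho : R) : 0 < rho ->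
  (forall a b, Cmod a <= rho -> Cmod b <= rho -> Cmod (T a - T b) <= 1 / 2 * Cmod (a - b)) ->
  Cmod (T 0) <= rho / 2 ->
  exists s, Cmod s <= rho /\ s = T s.
Proof.
  intros Hr HT H0.
  set (v := fix v n := match n with O => RtoC 0 | S n => T (v n) end).
  assert (Hv : forall n, Cmod (v n) <= rho).
  { induction n as [|n IH]; simpl; [rewrite Cmod_0; lra|].
    replace (T (v n)) with (T (v n) - T 0 + T 0) by ring.
    eapply Rle_trans; [apply Cmod_triangle|].
    assert (H1 := HT (v n) 0 IH ltac:(rewrite Cmod_0; lra)). rewrite Cminus_0_r in H1. lra. }
  set (t := fun n => v (S n) - v n).
  assert (Ht : forall n, Cmod (t n) <= rho / 2 * (1 / 2) ^ n).
  { induction n as [|n IH].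
    - unfold t. simpl. rewrite Cminus_0_r. lra.
    - assert (H1 : Cmod (t (S n)) <= 1 / 2 * Cmod (t n)) by exact (HT _ _ (Hv (S n)) (Hv n)).
      simpl pow. lra. }
  destruct (cseries_exists t _ Ht) as [s Hs].
  assert (Hsum : forall N, @eq C (csum t N) (v (S N))).
  { induction N as [|N IH].
    - rewrite csum_0. apply (Cminus_0_r (T 0)).
    - rewrite csum_S, IH. unfold t. ring. }
  assert (Hs1 : Cmod s <= rho).
  { apply (cseries_Cmod_le _ _ _ Hs). intros N. rewrite Hsum. apply Hv. }
  assert (Hl : clim eventually (fun n => v (S n)) s).
  { apply clim_ext with (csum t); [now apply filter_forall|]. now apply cseries_clim. }
  exists s. split; auto.
  apply (clim_unique (F := eventually) _ (fun n => v (S (S n)))).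
  - intros eps Heps. destruct (Hl eps Heps) as [N HN]. exists N. intros n Hn. apply HN. lia.
  - intros eps Heps. generalize (Hl eps Heps). apply filter_imp. intros n Hn.
    change (v (S (S n))) with (T (v (S n))).
    eapply Rle_lt_trans; [apply HT; [apply Hv|exact Hs1]|].
    generalize (Cmod_ge_0 (v (S n) - s)). lra.
Qed.

(* The equation s = P(z) + Q(z) E(s) covers both the inversion of a germ tangent to the
   identity (P = z, Q = -1) and the perturbation of the logarithm (Q = z). *)
Lemma implicit_germ (P Q E : C -> C) (e : C) :
  hol 0 P -> hol 0 Q -> hol 0 E -> P 0 = 0 -> E 0 = 0 ->
  cderiv E 0 e -> Q 0 * e = 0 ->
  exists s, hol 0 s /\ s 0 = 0 /\ near0 (fun z => s z = P z + Q z * E (s z)) /\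
    exists rho, 0 < rho /\
      near0 (fun z => forall v, Cmod v < rho -> v = P z + Q z * E v -> v = s z).
Proof.
  intros [P' HP] HQ [E' HE] HP0 HE0 He HQe.
  assert (HQc := hol_cont _ _ HQ). destruct HQ as [Q' HQ].
  assert (HPc := cderiv_cont _ _ _ (proj1 (nbhd_center _ _ HP))).
  destruct (nbhd_center _ _ HE) as [HE1 HE2].
  rewrite (cderiv_unique E 0 e (E' 0) He HE1) in HQe. clear He e HE1.
  generalize (Cmod_ge_0 (Q 0)) (Cmod_ge_0 (E' 0)). intros Hq0 He0.
  (* One of |Q 0|, |E' 0| is 0, so (|Q 0| + eta)(|E' 0| + eta) is at most eta (1 + |Q 0| + |E' 0|) =
     1/4. The factor 2 of [cderiv_lipschitz] makes this the contraction constant 1/2. *)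
  set (eta := (1 / (4 * (1 + Cmod (Q 0) + Cmod (E' 0))))%R).
  assert (Heta : 0 < eta) by (apply Rdiv_lt_0_compat; lra).
  assert (Heta1 : eta <= 1) by (apply Rle_div_l; lra).
  assert (Hprod : (Cmod (Q 0) * Cmod (E' 0) = 0)%R) by now rewrite <- Cmod_mult, HQe, Cmod_0.
  set (K := (Cmod (E' 0) + eta)%R).
  assert (HKQ : (Cmod (Q 0) + eta) * K <= 1 / 4).
  { unfold K. apply Rle_trans with (eta * (1 + Cmod (Q 0) + Cmod (E' 0)))%R.
    - nra.
    - unfold eta. apply Req_le. field. lra. }
  assert (HK : 0 <= K) by (unfold K; lra).
  destruct (proj1 (nbhd_iff _ _) (filter_and _ _ HE (HE2 eta Heta))) as [rho [Hrho Hball]].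
  assert (HEr : forall v, Cmod v < rho -> cderiv E v (E' v) /\ ccont E' v /\ Cmod (E' v) <= K).
  { intros v Hv. destruct (Hball v) as [[K1 K2] K3]; [now rewrite Cminus_0_r|].
    split; [|split]; auto. generalize (Cmod_minus_triangle (E' v) (E' 0)). unfold K. lra. }
  assert (Hlip : forall a b, Cmod a < rho -> Cmod b < rho -> Cmod (E a - E b) <= 2 * K * Cmod (a - b)).
  { intros a b Ha Hb. apply (cderiv_lipschitz E E' 0 rho).
    - intros w Hw. rewrite Cminus_0_r in Hw. now destruct (HEr w Hw) as [? [? ?]].
    - now rewrite Cminus_0_r.
    - now rewrite Cminus_0_r. }
  (* The fixed point is sought in the disc of radius [rho / 2], so [P z], the image of 0, must be
     within [rho / 4]. Uniqueness will hold in the whole open disc of radius [rho]. *)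
  assert (Hr4 : 0 < rho / 4) by lra.
  destruct (proj1 (nbhd_iff _ _) (filter_and _ _ (filter_and _ _ HP HQ)
    (filter_and _ _ (HQc eta Heta) (HPc _ Hr4)))) as [d [Hd Hz]].
  assert (HPQ : forall z, Cmod z < d -> (cderiv P z (P' z) /\ ccont P' z) /\
    (cderiv Q z (Q' z) /\ ccont Q' z) /\ Cmod (Q z) * (2 * K) <= 1 / 2 /\ Cmod (P z) <= rho / 4).
  { intros z Hzd. destruct (Hz z) as [[K1 K2] [K3 K4]]; [now rewrite Cminus_0_r|].
    split; [|split; [|split]]; auto.
    - generalize (Cmod_minus_triangle (Q z) (Q 0)). intros H.
      assert (Cmod (Q z) * K <= (Cmod (Q 0) + eta) * K) by (apply Rmult_le_compat_r; lra). lra.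
    - rewrite HP0, Cminus_0_r in K4. lra. }
  clear Hz Hball HQc HPc HE HP HQ.
  assert (HTlip : forall z a b, Cmod z < d -> Cmod a < rho -> Cmod b < rho ->
    Cmod (Q z * (E a - E b)) <= 1 / 2 * Cmod (a - b)).
  { intros z a b Hzd Ha Hb. destruct (HPQ z Hzd) as [_ [_ [HQz _]]]. rewrite Cmod_mult.
    eapply Rle_trans; [apply Rmult_le_compat_l; [apply Cmod_ge_0|now apply Hlip]|].
    rewrite <- Rmult_assoc. apply Rmult_le_compat_r; [apply Cmod_ge_0|auto]. }
  assert (Hex : forall z, exists s : C, Cmod z < d -> Cmod s <= rho / 2 /\ s = P z + Q z * E s).
  { intros z. destruct (Rlt_dec (Cmod z) d) as [Hzd|Hn]; [|exists (RtoC 0); easy].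
    destruct (contraction_fixpoint (fun s => P z + Q z * E s) (rho / 2)) as [s Hs].
    - lra.
    - intros a b Ha Hb.
      replace (P z + Q z * E a - (P z + Q z * E b)) with (Q z * (E a - E b)) by ring.
      apply HTlip; lra.
    - rewrite HE0, Cmult_0_r, Cplus_0_r. destruct (HPQ z Hzd) as [_ [_ [_ HPz]]]. lra.
    - exists s. auto. }
  set (s := fun z => proj1_sig (constructive_indefinite_description _ (Hex z))).
  assert (Hs : forall z, Cmod z < d -> Cmod (s z) <= rho / 2 /\ s z = P z + Q z * E (s z)).
  { intros z. exact (proj2_sig (constructive_indefinite_description _ (Hex z))). }
  clearbody s. clear Hex.
  assert (Huniq : forall z v, Cmod z < d -> Cmod v < rho -> v = P z + Q z * E v -> v = s z).
  { intros z v Hzd Hv Ev. destruct (Hs z Hzd) as [Hs1 Hs2].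
    assert (H1 := HTlip z v (s z) Hzd Hv ltac:(lra)).
    replace (Q z * (E v - E (s z))) with (v - s z) in H1 by (rewrite Ev at 1; rewrite Hs2 at 1; ring).
    apply Ceq_minus, Cmod_eq_0. generalize (Cmod_ge_0 (v - s z)). lra. }
  assert (Hnear : near0 (fun z => Cmod z < d)).
  { apply nbhd_iff. exists d. split; auto. intros w. now rewrite Cminus_0_r. }
  exists s. split; [|split; [|split]].
  2:{ symmetry. apply Huniq; try (rewrite Cmod_0; lra). rewrite HP0, HE0. ring. }
  2:{ generalize Hnear. apply filter_imp. intros z Hzd. now apply Hs. }
  2:{ exists rho. split; auto. generalize Hnear. apply filter_imp. intros z Hzd v. now apply Huniq. }
  (* By contraction, [Q z * (E (s z) - E (s w))] is at most half of the left-hand side [s z - s w]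
     and is absorbed into it, whence the factor 2 below. *)
  assert (Hscont : forall w, Cmod w < d -> ccont s w).
  { intros w Hw. destruct (Hs w Hw) as [Hw1 Hw2].
    destruct (HPQ w Hw) as [[HP1 _] [[HQ1 _] _]].
    assert (Hwd : nbhd w (fun z => Cmod z < d)).
    { apply nbhd_iff. exists (d - Cmod w)%R. split; [lra|]. intros z Hz.
      generalize (Cmod_minus_triangle z w). lra. }
    apply clim_ext with (fun z => s w + (s z - s w)).
    { apply filter_forall. intros z. ring. }
    apply clim_eq with (s w + 0); [|ring]. apply clim_plus; [apply clim_const|].
    apply clim_squeeze0 with (fun z => RtoC 2 * (P z - P w + (Q z - Q w) * E (s w))).
    - generalize Hwd. apply filter_imp. intros z Hzd. destruct (Hs z Hzd) as [Hz1 Hz2].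
      assert (H1 := HTlip z (s z) (s w) Hzd ltac:(lra) ltac:(lra)).
      assert (Es : s z - s w = P z - P w + (Q z - Q w) * E (s w) + Q z * (E (s z) - E (s w))).
      { rewrite Hz2 at 1. rewrite Hw2 at 1. ring. }
      assert (H2 : Cmod (s z - s w) <= Cmod (P z - P w + (Q z - Q w) * E (s w))
        + Cmod (Q z * (E (s z) - E (s w)))) by (rewrite Es at 1; apply Cmod_triangle).
      rewrite Cmod_mult, Cmod_R, Rabs_right by lra. lra.
    - apply clim_eq with (RtoC 2 * (P w - P w + (Q w - Q w) * E (s w))); [|ring].
      apply clim_mult; [apply clim_const|]. apply clim_plus; [|apply clim_mult].
      + apply clim_minus; [eapply cderiv_cont; eauto|apply clim_const].
      + apply clim_minus; [eapply cderiv_cont; eauto|apply clim_const].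
      + apply clim_const. }
  assert (Hden : forall w, Cmod w < d -> 1 - Q w * E' (s w) <> 0).
  { intros w Hw E0. destruct (Hs w Hw) as [Hw1 _].
    destruct (HPQ w Hw) as [_ [_ [HQw _]]]. destruct (HEr (s w) ltac:(lra)) as [_ [_ HEw]].
    assert (E1 : Q w * E' (s w) = 1).
    { replace (Q w * E' (s w)) with (1 - (1 - Q w * E' (s w))) by ring. rewrite E0. ring. }
    apply (f_equal Cmod) in E1. rewrite Cmod_mult, Cmod_1 in E1.
    assert (Cmod (Q w) * Cmod (E' (s w)) <= Cmod (Q w) * K).
    { apply Rmult_le_compat_l; [apply Cmod_ge_0|auto]. }
    lra. }
  (* Implicit differentiation of s = P + Q E(s). The same computation with slopes in place of
     derivatives gives the [q] used below. *)
  exists (fun w => (P' w + Q' w * E (s w)) / (1 - Q w * E' (s w))).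
  generalize Hnear. apply filter_imp. intros w Hw.
  destruct (Hs w Hw) as [Hw1 Hw2].
  destruct (HPQ w Hw) as [[HP1 HP2] [[HQ1 HQ2] [HQw _]]].
  destruct (HEr (s w) ltac:(lra)) as [HE1 [HE3 _]].
  assert (Hsw := Hscont w Hw). assert (Hdw := Hden w Hw).
  assert (HQcw := cderiv_cont _ _ _ HQ1).
  assert (HEcw := cderiv_cont _ _ _ HE1).
  split.
  - destruct HP1 as [qP [EP [HqP CP]]], HQ1 as [qQ [EQ [HqQ CQ]]], HE1 as [qE [EE [HqE CE]]].
    set (q := fun z => (qP z + qQ z * E (s w)) / (1 - Q z * qE (s z))).
    assert (Hlim : clim (nbhd w) (fun z => 1 - Q z * qE (s z)) (1 - Q w * E' (s w))).
    { apply clim_minus; [apply clim_const|]. apply clim_mult; auto.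
      rewrite <- HqE. now apply clim_comp. }
    assert (Hqw : q w = (P' w + Q' w * E (s w)) / (1 - Q w * E' (s w))).
    { unfold q. now rewrite HqP, HqQ, HqE. }
    apply cderiv_of_quotient with q; auto.
    + assert (Hwd : nbhd w (fun z => Cmod z < d)).
      { apply nbhd_iff. exists (d - Cmod w)%R. split; [lra|]. intros z Hz.
        generalize (Cmod_minus_triangle z w). lra. }
      generalize (filter_and _ _ Hwd (clim_neq0 _ _ Hdw Hlim)). apply filter_imp.
      intros z [Hzd Hne] _. destruct (Hs z Hzd) as [Hz1 Hz2].
      assert (Es : (s z - s w) * (1 - Q z * qE (s z)) = (qP z + qQ z * E (s w)) * (z - w)).
      { replace ((s z - s w) * (1 - Q z * qE (s z)))
          with (s z - s w - Q z * (qE (s z) * (s z - s w))) by ring.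
        replace (qE (s z) * (s z - s w)) with (E (s z) - E (s w)) by (rewrite (EE (s z)); ring).
        rewrite Hz2 at 1. rewrite Hw2 at 1.
        replace ((qP z + qQ z * E (s w)) * (z - w))
          with (P z - P w + (Q z - Q w) * E (s w)) by (rewrite (EP z), (EQ z); ring).
        ring. }
      unfold q.
      replace ((qP z + qQ z * E (s w)) / (1 - Q z * qE (s z)) * (z - w))
        with ((qP z + qQ z * E (s w)) * (z - w) / (1 - Q z * qE (s z))) by (field; auto).
      rewrite <- Es. field. auto.
    + apply ccont_intro with ((P' w + Q' w * E (s w)) / (1 - Q w * E' (s w))); auto.
      apply clim_div; auto. apply clim_plus; [rewrite <- HqP; exact CP|].
      apply clim_mult; [rewrite <- HqQ; exact CQ|apply clim_const].
  - apply clim_div; auto.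
    + apply clim_plus; auto. apply clim_mult; auto. apply (clim_comp E); auto.
    + apply clim_minus; [apply clim_const|]. apply clim_mult; auto.
      apply (clim_comp E'); auto.
Qed.

(** The factored form exhibits [phi z / z] as an analytic germ with value 1 at 0, to which
    logarithms and roots apply. *)
Lemma tangent_id_iff (phi : C -> C) :
  tangent_id phi <->
  exists u, analytic0 u /\ u 0 = 1 /\ near0 (fun z => phi z = z * u z).
Proof.
  split.
  - intros [a [H0 [H1 H]]]. destruct (expansion_decr phi a H) as [u [Hu E]].
    exists u. split; [now exists (fun n => a (S n))|]. split.
    + now rewrite (expansion_at0 u _ Hu).
    + generalize E. apply filter_imp. intros z ->. rewrite H0. ring.
  - intros [u [[b Hb] [H1 E]]].
    exists (@PS_incr_1 C_AbsRing C_NormedModule b). split; [reflexivity|]. split.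
    + simpl. now rewrite <- (expansion_at0 u b Hb).
    + apply expansion_ext with (fun z => z * u z); [|now apply expansion_incr].
      generalize E. apply filter_imp. now intros z ->.
Qed.

(** The inverse is the fixed point of v = z - (phi v - v), where [phi - id] has derivative 0 at 0.
    This gives phi o psi = id. For psi o phi = id, the equation at the point [phi z] is also solved
    by the small value [v = z], and uniqueness applies. *)
Lemma tangent_id_inverse (phi : C -> C) :
  tangent_id phi -> exists psi, germ_inverse phi psi.
Proof.
  intros Ht. assert (Hphi : hol 0 phi).
  { destruct Ht as [a [_ [_ H]]]. apply analytic0_hol. now exists a. }
  apply tangent_id_iff in Ht. destruct Ht as [u [Hu [Hu1 E]]].
  assert (Hphi0 : phi 0 = 0) by (rewrite (nbhd_center _ _ E); ring).
  destruct (implicit_germ (fun z => z) (fun _ => - (1)) (fun z => phi z - z) 0)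
    as [psi [Hpsi [Hpsi0 [Heq [rho [Hrho Huniq]]]]]].
  - apply hol_id.
  - apply hol_const.
  - apply hol_minus; auto. apply hol_id.
  - reflexivity.
  - rewrite Hphi0. ring.
  - apply cderiv_of_quotient with (fun z => u z - 1).
    + generalize E. apply filter_imp. intros z -> _. rewrite Hphi0. ring.
    + rewrite Hu1. ring.
    + apply clim_minus; [|apply clim_const]. now apply hol_cont, analytic0_hol.
  - ring.
  - exists psi. split; [now apply hol_analytic0|]. split; auto. split.
    + assert (Halg : forall a b : C, a = b + - (1) * (b - a)) by (intros; ring).
      assert (Hc := hol_cont _ _ Hphi). unfold ccont in Hc. rewrite Hphi0 in Hc.
      generalize (filter_and _ _ (clim_nbhd _ _ _ Hc Huniq) (clim_id (RtoC 0) rho Hrho)).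
      apply filter_imp. intros z [H1 H2]. symmetry. apply H1.
      * now rewrite Cminus_0_r in H2.
      * apply Halg.
    + generalize Heq. apply filter_imp. intros z Hz.
      replace (phi (psi z)) with (psi z - (z + - (1) * (phi (psi z) - psi z)) + z) by ring.
      rewrite <- Hz. ring.
Qed.

(** * The generalized Abel equation *)

Lemma o_pow_bound (n : nat) (e : C -> C) (eps : R) :
  o_pow n e -> 0 < eps -> near0 (fun z => Cmod (e z) <= eps * Cmod (z ^ n)).
Proof. intros H Heps. exact (H (mkposreal eps Heps)). Qed.

(** Domination holds on a full neighborhood, hence at 0 itself, where [Cmod (0 ^ n)] is at most 1
    and epsilon is arbitrary. This is the source of the values of [f] and [g] at 0. *)
Lemma o_pow_at0 (n : nat) (e : C -> C) : o_pow n e -> e 0 = 0.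
Proof.
  intros H. destruct (Ceq_dec (e 0) 0) as [|Hn]; auto. exfalso.
  apply Cmod_gt_0 in Hn.
  assert (He : 0 < Cmod (e 0) / 2) by lra.
  assert (H1 := nbhd_center _ _ (o_pow_bound n e _ H He)). cbv beta in H1.
  assert (H2 : Cmod (0 ^ n) <= 1).
  { rewrite Cmod_pow, Cmod_0. destruct n; simpl; lra. }
  generalize (Cmod_ge_0 (0 ^ n)). intros H3. nra.
Qed.

Lemma o_pow_clim (n : nat) (e : C -> C) : o_pow n e -> clim near0' (fun z => e z / z ^ n) 0.
Proof.
  intros H eps Heps. assert (He : 0 < eps / 2) by lra.
  generalize (filter_and _ _ (near0_punctured _ (o_pow_bound n e _ H He)) punctured_neq0).
  apply filter_imp. intros z [H1 H2]. rewrite Cminus_0_r.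
  assert (Hp := Cpow_nz z n H2). rewrite Cmod_div by auto. apply Cmod_gt_0 in Hp.
  apply Rlt_div_l; auto. nra.
Qed.

Lemma o_pow_leading (n : nat) (g : C -> C) (a : C) :
  o_pow n (fun z => g z - a * z ^ n) -> clim near0' (fun z => g z / z ^ n) a.
Proof.
  intros H. apply o_pow_clim in H.
  apply clim_ext with (fun z => (g z - a * z ^ n) / z ^ n + a).
  - generalize punctured_neq0. apply filter_imp. intros z Hz. field. now apply Cpow_nz.
  - apply clim_eq with (0 + a); [|ring]. apply clim_plus; auto. apply clim_const.
Qed.

(** If [g / z ^ n] has a limit, multiplying by a positive power of [z] makes every quotient by a
    lower power tend to 0, against a nonzero limit. *)
Lemma leading_order_unique (g : C -> C) (m n : nat) (a b : C) :
  a <> 0 -> b <> 0 ->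
  clim near0' (fun z => g z / z ^ m) a -> clim near0' (fun z => g z / z ^ n) b ->
  m = n /\ a = b.
Proof.
  assert (K : forall (m d : nat) (a b : C), b <> 0 -> clim near0' (fun z => g z / z ^ (m + S d)) a ->
    clim near0' (fun z => g z / z ^ m) b -> False).
  { clear. intros m d a b Hb Ha Hb'. apply Hb.
    apply (clim_unique (F := near0') _ (fun z => g z / z ^ m)); auto.
    apply clim_ext with (fun z => g z / z ^ (m + S d) * z ^ S d).
    - generalize punctured_neq0. apply filter_imp. intros z Hz. rewrite Cpow_add_r.
      field. split; now apply Cpow_nz.
    - apply clim_eq with (a * 0 ^ S d); [|rewrite Cpow_S; ring].
      apply clim_mult; auto. apply clim_pow, clim_punctured_id. }
  intros Ha Hb H1 H2. destruct (Nat.lt_trichotomy m n) as [Hlt|[->|Hlt]].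
  - exfalso. replace n with (m + S (n - S m))%nat in H2 by lia. exact (K _ _ _ _ Ha H2 H1).
  - split; auto. exact (clim_unique (F := near0') _ _ _ _ H1 H2).
  - exfalso. replace m with (n + S (m - S n))%nat in H1 by lia. exact (K _ _ _ _ Hb H1 H2).
Qed.

(** The factorization is asserted off 0 only; [f 0 = 0] is recorded separately for equations on a
    full neighborhood. *)
Definition parabolic (f : C -> C) : Prop :=
  f 0 = 0 /\ exists p, clim near0' p 1 /\ near0' (fun z => f z = z * (1 + z * p z)).

Lemma prenormalized_parabolic (f : C -> C) : prenormalized f -> parabolic f.
Proof.
  intros [_ H]. split.
  - generalize (o_pow_at0 _ _ H). cbv beta. rewrite !Cpow_S. intros E.
    replace (f 0) with (f 0 - (0 + 0 * (0 * 0 ^ 0) + 0 * (0 * (0 * 0 ^ 0)))) by ring. exact E.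
  - exists (fun z => 1 + z + (f z - (z + z ^ 2 + z ^ 3)) / z ^ 3 * z). split.
    + apply clim_eq with (1 + 0 + 0 * 0); [|ring].
      apply clim_plus; [apply clim_plus; [apply clim_const|apply clim_punctured_id]|].
      apply clim_mult; [now apply o_pow_clim|apply clim_punctured_id].
    + generalize punctured_neq0. apply filter_imp. intros z Hz.
      rewrite !Cpow_S. change (z ^ 0) with (RtoC 1). field. auto.
Qed.

(** A limit 0 alone does not transport [near0']: the values of [u] must also avoid 0. *)
Lemma punctured_comp (u : C -> C) (P : C -> Prop) :
  clim near0' u 0 -> near0' (fun z => u z <> 0) -> near0' P -> near0' (fun z => P (u z)).
Proof.
  intros Hu Hn HP. generalize (filter_and _ _ Hn (clim_nbhd u 0 _ Hu HP)).
  apply filter_imp. intros z [H1 H2]. exact (H2 H1).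
Qed.

Lemma parabolic_facts (f : C -> C) : parabolic f ->
  clim near0' f 0 /\ clim near0' (fun z => f z / z) 1 /\ near0' (fun z => f z <> 0).
Proof.
  intros [_ [p [Hp E]]].
  assert (H1 : clim near0' (fun z => f z / z) 1).
  { apply clim_ext with (fun z => 1 + z * p z).
    - generalize (filter_and _ _ E punctured_neq0). apply filter_imp. intros z [-> Hz].
      field. auto.
    - apply clim_eq with (1 + 0 * 1); [|ring]. apply clim_plus; [apply clim_const|].
      apply clim_mult; auto. apply clim_punctured_id. }
  split; [|split]; auto.
  - apply clim_ext with (fun z => f z / z * z).
    + generalize punctured_neq0. apply filter_imp. intros z Hz. field. auto.
    + apply clim_eq with (1 * 0); [|ring]. apply clim_mult; auto. apply clim_punctured_id.
  - generalize (filter_and _ _ (clim_neq0 _ _ C1_nz H1) punctured_neq0). apply filter_imp.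
    intros z [H2 Hz] E0. apply H2. rewrite E0. unfold Cdiv. ring.
Qed.

Lemma tangent_id_facts (phi : C -> C) : tangent_id phi ->
  hol 0 phi /\ clim near0' phi 0 /\ clim near0' (fun z => phi z / z) 1 /\
  near0' (fun z => phi z <> 0).
Proof.
  intros Ht. assert (Hh : hol 0 phi).
  { destruct Ht as [a [_ [_ H]]]. apply analytic0_hol. now exists a. }
  apply tangent_id_iff in Ht. destruct Ht as [u [Hu [Hu1 E]]].
  assert (H0 : phi 0 = 0) by (rewrite (nbhd_center _ _ E); ring).
  assert (H1 : clim near0' (fun z => phi z / z) 1).
  { apply clim_ext with u.
    - generalize (filter_and _ _ (near0_punctured _ E) punctured_neq0). apply filter_imp.
      intros z [-> Hz]. field. auto.
    - rewrite <- Hu1. apply (clim_sub near0); [exact near0_punctured|].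
      now apply hol_cont, analytic0_hol. }
  split; [|split; [|split]]; auto.
  - apply clim_eq with (phi 0); auto. apply (clim_sub near0); [exact near0_punctured|]. now apply hol_cont.
  - generalize (filter_and _ _ (clim_neq0 _ _ C1_nz H1) punctured_neq0). apply filter_imp.
    intros z [H2 Hz] E0. apply H2. rewrite E0. unfold Cdiv. ring.
Qed.

(** Excluded middle on the coefficients of positive degree. If [a (S n)] is nonzero, dividing by [z]
    at most [S n] times reaches the first nonzero one, which becomes [E 0]. *)
Lemma analytic0_cases (D : C -> C) : analytic0 D ->
  near0 (fun z => D z = D 0) \/
  exists m E, analytic0 E /\ E 0 <> 0 /\ near0 (fun z => D z = D 0 + z ^ S m * E z).
Proof.
  intros [a H]. destruct (classic (exists n, a (S n) <> 0)) as [[n Hn]|Hn].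
  - right. revert D a H Hn. induction n as [|n IH]; intros D a H Hn;
      destruct (expansion_decr D a H) as [D1 [H1 E1]];
      rewrite (expansion_at0 D a H); assert (E0 := expansion_at0 D1 _ H1); cbv beta in E0.
    + exists 0%nat, D1. split; [now eexists; eassumption|]. split; [now rewrite E0|].
      generalize E1. apply filter_imp. intros z ->. now rewrite Cpow_1_r.
    + destruct (Ceq_dec (a 1%nat) 0) as [Ha|Ha].
      * destruct (IH D1 _ H1 Hn) as [m [E [HE [HE0 Heq]]]].
        exists (S m), E. split; auto. split; auto.
        generalize (filter_and _ _ E1 Heq). apply filter_imp. intros z [-> ->].
        rewrite E0, Ha, (Cpow_S z (S m)). ring.
      * exists 0%nat, D1. split; [now eexists; eassumption|]. split; [now rewrite E0|].
        generalize E1. apply filter_imp. intros z ->. now rewrite Cpow_1_r.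
  - left. generalize H. unfold has_expansion. apply filter_imp. intros z Hz.
    rewrite (expansion_at0 D a H). apply cpseries_cseries, cseries_clim in Hz.
    apply (clim_unique _ _ _ _ Hz). apply clim_ext with (fun _ => a 0%nat); [|apply clim_const].
    apply filter_forall. intros k. induction k as [|k IH].
    + rewrite csum_0. change (a 0%nat = 1 * a 0%nat). ring.
    + rewrite csum_S, <- IH. destruct (Ceq_dec (a (S k)) 0) as [Ha|Ha].
      * change (a 0%nat = a 0%nat + z ^ S k * a (S k)). rewrite Ha. ring.
      * exfalso. apply Hn. now exists k.
Qed.

(** [S] is the polynomial ((1 + x)^n - 1) / x, built by the recursion S_(n+1) = 1 + (1 + x) S_n so
    that no division by [x] occurs. *)
Lemma binomial_remainder (n : nat) :
  exists S : C -> C, (forall x, (1 + x) ^ n = 1 + x * S x) /\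
    forall u, clim near0' u 0 -> clim near0' (fun z => S (u z)) (RtoC (INR n)).
Proof.
  induction n as [|n [S [HS Hlim]]].
  - exists (fun _ => RtoC 0). split.
    + intros x. change (RtoC 1 = 1 + x * 0). ring.
    + intros u _. apply clim_const.
  - exists (fun x => 1 + (1 + x) * S x). split.
    + intros x. rewrite Cpow_S, HS. ring.
    + intros u Hu. rewrite S_INR, RtoC_plus.
      apply clim_eq with (1 + (1 + 0) * RtoC (INR n)); [|ring].
      apply clim_plus; [apply clim_const|]. apply clim_mult; [|now apply Hlim].
      apply clim_plus; [apply clim_const|exact Hu].
Qed.

(** Since f^(m+1) = z^(m+1) (1 + z p S'(z p)), the quotient splits into p S'(z p) E(f), which tends
    to (m + 1) E(0), and (E(f) - E) / z. In the latter the slope of [E] at 0 occurs with both signs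
    and cancels in the limit. *)
Lemma abel_difference_leading (f D E : C -> C) (m : nat) (d : C) :
  parabolic f -> analytic0 E -> near0 (fun z => D z = d + z ^ S m * E z) ->
  clim near0' (fun z => (D (f z) - D z) / z ^ S (S m)) (RtoC (INR (S m)) * E 0).
Proof.
  intros Hf HE HD. destruct (parabolic_facts f Hf) as [Hf0 [Hf1 Hfn]].
  destruct Hf as [_ [p [Hp Ef]]]. apply analytic0_hol in HE.
  assert (HEc := hol_cont _ _ HE).
  destruct HE as [E' HE]. destruct (nbhd_center _ _ HE) as [[q [Eq [_ Hq]]] _].
  destruct (binomial_remainder (S m)) as [S' [HS HSlim]].
  apply clim_ext with (fun z => p z * S' (z * p z) * E (f z) + q (f z) * (1 + z * p z) - q z).
  - assert (HDf := clim_nbhd f 0 _ Hf0 HD).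
    generalize (filter_and _ _ (filter_and _ _ Ef punctured_neq0)
      (filter_and _ _ HDf (near0_punctured _ HD))).
    apply filter_imp. intros z [[H1 Hz] [H2 H3]]. rewrite H2, H3.
    assert (Hfz : f z ^ S m = z ^ S m * (1 + z * p z * S' (z * p z))).
    { rewrite H1 at 1. rewrite Cpow_mult_l, HS. ring. }
    rewrite Hfz, (Cpow_S z (S m)). rewrite (Eq z).
    assert (E1 : E (f z) = E 0 + q (f z) * (z * (1 + z * p z))).
    { rewrite <- H1. rewrite (Eq (f z)) at 1. ring. }
    rewrite E1. field. split; auto. now apply Cpow_nz.
  - apply clim_eq with (1 * RtoC (INR (S m)) * E 0 + q 0 * (1 + 0 * 1) - q 0); [|ring].
    assert (Hzp : clim near0' (fun z => z * p z) (0 * 1)).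
    { apply clim_mult; auto. apply clim_punctured_id. }
    apply clim_minus; [apply clim_plus|].
    + apply clim_mult; [apply clim_mult; auto|].
      * apply HSlim. apply clim_eq with (0 * 1); [exact Hzp|ring].
      * now apply clim_comp.
    + apply clim_mult; [now apply clim_comp|].
      apply clim_plus; [apply clim_const|exact Hzp].
    + apply (clim_sub near0); [exact near0_punctured|exact Hq].
Qed.

Lemma invariant_constant (f D : C -> C) :
  parabolic f -> analytic0 D -> near0' (fun z => D (f z) - D z = 0) ->
  near0 (fun z => D z = D 0).
Proof.
  intros Hf HD Hinv. destruct (analytic0_cases D HD) as [|[m [E [HE [HE0 Heq]]]]]; auto.
  exfalso. apply (Cmult_neq_0 _ _ (INR_S_neq0 m) HE0).
  apply (clim_unique (F := near0') _ _ _ _ (abel_difference_leading f D E m (D 0) Hf HE Heq)).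
  apply clim_ext with (fun _ => 0); [|apply clim_const].
  generalize Hinv. apply filter_imp. intros z ->. unfold Cdiv. ring.
Qed.

(** * Ratios near 1 and the case k <= 1 *)

Lemma near_1_Re_pos (u : C -> C) : clim near0' u 1 -> near0' (fun z => 0 < Re (u z)).
Proof.
  intros H. apply (clim_nbhd u 1 (fun w => 0 < Re w) H). apply nbhd_Re_pos. simpl. lra.
Qed.

Lemma comp_ratio_1 (f phi : C -> C) : parabolic f -> tangent_id phi ->
  clim near0' (fun z => phi (f z) / f z) 1 /\ clim near0' (fun z => phi (f z) / phi z) 1.
Proof.
  intros Hf Hphi. destruct (parabolic_facts f Hf) as [Hf0 [Hf1 Hfn]].
  destruct (tangent_id_facts phi Hphi) as [_ [Hp0 [Hp1 Hpn]]].
  assert (H1 : clim near0' (fun z => phi (f z) / f z) 1).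
  { intros eps Heps. apply (punctured_comp f (fun z => Cmod (phi z / z - 1) < eps)); auto. }
  split; auto.
  apply clim_ext with (fun z => phi (f z) / f z * (f z / z) / (phi z / z)).
  - generalize (filter_and _ _ (filter_and _ _ Hpn Hfn) punctured_neq0). apply filter_imp.
    intros z [[Ha Hb] Hz]. field. auto.
  - apply clim_eq with (1 * 1 / 1); [|field; apply C1_nz].
    apply clim_div; auto using C1_nz. now apply clim_mult.
Qed.

(* Both sides are Log (phi (f z) / z). *)
Lemma Clog_cocycle (f phi : C -> C) : parabolic f -> tangent_id phi ->
  near0' (fun z => Clog (phi (f z) / f z) + Clog (f z / z)
    = Clog (phi (f z) / phi z) + Clog (phi z / z)).
Proof.
  intros Hf Hphi. destruct (parabolic_facts f Hf) as [_ [Hf1 Hfn]].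
  destruct (tangent_id_facts phi Hphi) as [_ [_ [Hp1 Hpn]]].
  destruct (comp_ratio_1 f phi Hf Hphi) as [Hr1 Hr2].
  assert (H3 := clim_mult _ _ _ _ Hr1 Hf1). assert (H4 := clim_mult _ _ _ _ Hr2 Hp1).
  rewrite Cmult_1_l in H3, H4.
  generalize (filter_and _ _ (filter_and _ _ (filter_and _ _ Hpn Hfn) punctured_neq0)
    (filter_and _ _ (filter_and _ _ (filter_and _ _ (near_1_Re_pos _ Hr1) (near_1_Re_pos _ Hf1))
      (filter_and _ _ (near_1_Re_pos _ Hr2) (near_1_Re_pos _ Hp1)))
      (filter_and _ _ (near_1_Re_pos _ H3) (near_1_Re_pos _ H4)))).
  apply filter_imp. intros z [[[Ha Hb] Hz] [[[K1 K2] [K3 K4]] [K5 K6]]].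
  rewrite <- !Clog_mult by auto. f_equal. field. auto.
Qed.

(** The germ h o phi - h. The pole of h and [Clog z] cancel in it, which leaves the regular part of
    the solution h o phi. *)
Definition h_defect (a0 a1 : C) (phi : C -> C) (z : C) : C :=
  a0 * (1 / z - 1 / phi z) + a1 * Clog (phi z / z).

Lemma h_comp_defect (a0 a1 : C) (phi : C -> C) (z : C) :
  h_comp a0 a1 phi z = h a0 a1 z + h_defect a0 a1 phi z.
Proof. unfold h_comp, h, h_defect, Cdiv. ring. Qed.

(** With phi = z u and u = 1 + z u1, the polar difference 1/z - 1/phi equals u1 / u, and the
    logarithm is that of [u], which is near 1. *)
Lemma h_defect_analytic (a0 a1 : C) (phi : C -> C) : tangent_id phi ->
  exists R, analytic0 R /\ near0' (fun z => R z = h_defect a0 a1 phi z).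
Proof.
  intros Hphi. destruct (tangent_id_facts phi Hphi) as [_ [_ [_ Hpn]]].
  apply tangent_id_iff in Hphi. destruct Hphi as [u [[b Hb] [Hu1 E]]].
  destruct (expansion_decr u b Hb) as [u1 [Hu1' E1]].
  assert (Hb0 : b 0%nat = 1) by now rewrite <- (expansion_at0 u b Hb).
  assert (Hhu : hol 0 u) by (apply analytic0_hol; now exists b).
  exists (fun z => a0 * (u1 z / u z) + a1 * Clog (u z)). split.
  - apply hol_analytic0. apply hol_plus; apply hol_mult; try apply hol_const.
    + apply hol_div; auto.
      * rewrite Hu1. apply C1_nz.
      * apply analytic0_hol. eexists. exact Hu1'.
    + apply (hol_comp 0 Clog u); auto. rewrite Hu1. apply hol_Clog. simpl. lra.
  - generalize (filter_and _ _ (filter_and _ _ (near0_punctured _ E) (near0_punctured _ E1))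
      (filter_and _ _ Hpn punctured_neq0)).
    apply filter_imp. intros z [[H1 H2] [H3 H4]]. unfold h_defect.
    assert (Hu0 : u z <> 0).
    { intros E0. apply H3. rewrite H1, E0. ring. }
    rewrite H1. replace (z * u z / z) with (u z) by (field; auto).
    replace (u1 z) with ((u z - 1) / z) by (rewrite H2, Hb0; field; auto).
    replace ((u z - 1) / z / u z) with (1 / z - 1 / (z * u z)) by (field; auto). reflexivity.
Qed.

(** This links the modified equation for the regular part to the equation of [is_h_shift] for w =
    phi o f; it is read in both directions. *)
Lemma h_defect_difference (a0 a1 : C) (f phi : C -> C) : parabolic f -> tangent_id phi ->
  near0' (fun z => h_defect a0 a1 phi (f z) - h_defect a0 a1 phi z
    = - a0 * (1 / phi (f z) - 1 / phi z) + a1 * Clog (phi (f z) / phi z)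
      + a0 * (1 / f z - 1 / z) - a1 * Clog (f z / z)).
Proof.
  intros Hf Hphi. generalize (Clog_cocycle f phi Hf Hphi). apply filter_imp. intros z Hz.
  unfold h_defect.
  replace (Clog (phi (f z) / f z))
    with (Clog (phi (f z) / phi z) + Clog (phi z / z) - Clog (f z / z)) by (rewrite <- Hz; ring).
  ring.
Qed.

Lemma form_le1_solution (a0 a1 : C) (f g phi psi w : C -> C) :
  parabolic f -> tangent_id phi -> germ_inverse phi psi -> is_h_shift a0 a1 phi g w ->
  near0' (fun z => f z = psi (w z)) ->
  exists R, analytic0 R /\ near0' (fun z => h_comp a0 a1 phi z = h a0 a1 z + R z) /\
    near0' (fun z => R (f z) - R z = g z + a0 * (1 / f z - 1 / z) - a1 * Clog (f z / z)).
Proof.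
  intros Hf Hphi [_ [_ [_ Hpsi]]] [Hw1 Hw2] Hfw.
  destruct (parabolic_facts f Hf) as [Hf0 [_ Hfn]].
  destruct (tangent_id_facts phi Hphi) as [_ [Hp0 [_ Hpn]]].
  destruct (h_defect_analytic a0 a1 phi Hphi) as [R [HR ER]].
  exists R. split; auto. split.
  - generalize ER. apply filter_imp. intros z ->. apply h_comp_defect.
  (* As [w] tends to 0, it enters the domain where [phi] undoes [psi], so that [phi (f z) = w z]. *)
  - assert (Hw0 : clim near0' w 0).
    { apply clim_ext with (fun z => w z / phi z * phi z).
      - generalize Hpn. apply filter_imp. intros z Hz. field. auto.
      - apply clim_eq with (1 * 0); [|ring]. apply clim_mult; auto. now apply clim_filterlim. }
    assert (ERf := punctured_comp f _ Hf0 Hfn ER).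
    generalize (filter_and _ _ (filter_and _ _ ER ERf)
      (filter_and _ _ (filter_and _ _ (clim_nbhd w 0 _ Hw0 Hpsi) Hfw)
        (filter_and _ _ Hw2 (h_defect_difference a0 a1 f phi Hf Hphi)))).
    apply filter_imp. intros z [[H1 H2] [[H3 H4] [H5 H6]]].
    rewrite H1, H2, H6. replace (phi (f z)) with (w z) by (rewrite H4; auto).
    rewrite H5. ring.
Qed.

(* With phi = z / (1 - s), the equation becomes s = z (R - a1 Log (1 / (1 - s))) / a0. *)
Lemma h_defect_solve_pole (a0 a1 : C) (R : C -> C) : a0 <> 0 -> analytic0 R ->
  exists phi, tangent_id phi /\ near0' (fun z => h_defect a0 a1 phi z = R z).
Proof.
  intros Ha HR. apply analytic0_hol in HR.
  set (E := fun v => - (a1 / a0) * Clog (/ (1 - v))).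
  assert (E10 : 1 - 0 = 1) by ring.
  assert (Hi1 : / 1 = 1) by (field; apply C1_nz).
  assert (HE : hol 0 E).
  { apply hol_mult; [apply hol_const|]. apply (hol_comp 0 Clog (fun v => / (1 - v))).
    - rewrite E10, Hi1. apply hol_Clog. simpl. lra.
    - apply hol_inv; [rewrite E10; apply C1_nz|].
      apply hol_minus; [apply hol_const|apply hol_id]. }
  assert (HE' := HE). destruct HE' as [E' HE']. destruct (nbhd_center _ _ HE') as [He _].
  (* Here [Q = z] vanishes at 0, so the smallness condition holds whatever the derivative of [E]; no
     condition on [R 0] arises either. *)
  destruct (implicit_germ (fun z => z * (R z / a0)) (fun z => z) E (E' 0))
    as [s [Hs [Hs0 [Heq _]]]]; auto.
  - apply hol_mult; [apply hol_id|]. apply hol_div; auto. apply hol_const.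
  - apply hol_id.
  - ring.
  - unfold E. rewrite E10, Hi1, Clog_1. ring.
  - ring.
  - assert (Hs1 : 1 - s 0 <> 0) by (rewrite Hs0, E10; apply C1_nz).
    assert (Hh : hol 0 (fun z => 1 - s z)) by (apply hol_minus; auto; apply hol_const).
    exists (fun z => z * / (1 - s z)). split.
    + apply tangent_id_iff. exists (fun z => / (1 - s z)). split; [|split].
      * apply hol_analytic0. now apply hol_inv.
      * now rewrite Hs0, E10.
      * apply filter_forall. reflexivity.
    + assert (Hn := clim_neq0 _ _ Hs1 (hol_cont _ _ Hh)).
      generalize (filter_and _ _ (filter_and _ _ (near0_punctured _ Hn) (near0_punctured _ Heq))
        punctured_neq0).
      apply filter_imp. intros z [[H1 H2] H3]. unfold h_defect.
      replace (z * / (1 - s z) / z) with (/ (1 - s z)) by (field; auto).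
      replace (1 / z - 1 / (z * / (1 - s z))) with (s z / z) by (field; auto).
      rewrite H2 at 1. unfold E. field. auto.
Qed.

(** Without a pole the defect a1 Log (phi z / z) tends to 0, which is why [R 0] is subtracted. The
    equation is then solved by phi = z exp ((R - R 0) / a1). *)
Lemma h_defect_solve_log (a1 : C) (R : C -> C) : a1 <> 0 -> analytic0 R ->
  exists phi, tangent_id phi /\ near0' (fun z => h_defect 0 a1 phi z = R z - R 0).
Proof.
  intros Ha HR. apply analytic0_hol in HR.
  set (t := fun z => (R z - R 0) / a1).
  assert (Ht : hol 0 t).
  { apply hol_div; [exact Ha| |apply hol_const]. apply hol_minus; auto. apply hol_const. }
  assert (Ht0 : t 0 = 0) by (unfold t; field; auto).
  exists (fun z => z * Cexp (t z)). split.
  - apply tangent_id_iff. exists (fun z => Cexp (t z)). split; [|split].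
    + apply hol_analytic0. apply (hol_comp 0 Cexp t); auto. apply hol_Cexp.
    + rewrite Ht0. apply Cexp_0.
    + apply filter_forall. reflexivity.
  - assert (HPI : 0 < PI / 2) by (generalize PI_RGT_0; lra).
    assert (Htc := hol_cont _ _ Ht _ HPI).
    generalize (filter_and _ _ (near0_punctured _ Htc) punctured_neq0). apply filter_imp.
    intros z [H1 H2]. rewrite Ht0, Cminus_0_r in H1. unfold h_defect.
    replace (z * Cexp (t z) / z) with (Cexp (t z)) by (field; auto).
    rewrite Clog_Cexp.
    + unfold t. field. repeat split; auto using Cexp_neq0.
    + generalize (im_le_Cmod (t z)). intros H3.
      assert (H4 : Rabs (Im (t z)) < PI / 2) by lra. apply Rabs_def2 in H4. lra.
Qed.

(** The witness is w = phi o f, for which f = psi(w) is immediate. The constant [c], 0 in the pole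
    case and [R 0] in the logarithmic one, drops out of the difference along [f]. *)
Lemma defect_form_le1 (a0 a1 c : C) (f g phi R : C -> C) :
  parabolic f -> tangent_id phi ->
  near0' (fun z => h_defect a0 a1 phi z = R z - c) ->
  near0' (fun z => R (f z) - R z = g z + a0 * (1 / f z - 1 / z) - a1 * Clog (f z / z)) ->
  exists psi, germ_inverse phi psi /\
    exists w, is_h_shift a0 a1 phi g w /\ near0' (fun z => f z = psi (w z)).
Proof.
  intros Hf Hphi Hdef HR. destruct (parabolic_facts f Hf) as [Hf0 [_ Hfn]].
  destruct (tangent_id_inverse phi Hphi) as [psi Hpsi]. exists psi. split; auto.
  exists (fun z => phi (f z)). split; [split|].
  - apply clim_filterlim. now apply comp_ratio_1.
  - assert (Hdf := punctured_comp f _ Hf0 Hfn Hdef).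
    generalize (filter_and _ _ (filter_and _ _ Hdef Hdf)
      (filter_and _ _ HR (h_defect_difference a0 a1 f phi Hf Hphi))).
    apply filter_imp. intros z [[H1 H2] [H3 H4]].
    rewrite H1, H2 in H4.
    match goal with |- ?x = g z => set (X := x) in * end.
    replace (R (f z) - c - (R z - c)) with (R (f z) - R z) in H4 by ring.
    rewrite H3 in H4.
    replace X with (X + a0 * (1 / f z - 1 / z) - a1 * Clog (f z / z)
      - (a0 * (1 / f z - 1 / z) - a1 * Clog (f z / z))) by ring.
    rewrite <- H4. ring.
  - destruct Hpsi as [_ [_ [Hpsi _]]]. generalize (clim_nbhd f 0 _ Hf0 Hpsi).
    apply filter_imp. now intros z ->.
Qed.

(** * The case k >= 2, written k = S (S m) *)

Lemma root_argument_clim (m : nat) (a : C) (g phi : C -> C) :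
  tangent_id phi -> clim near0' (fun z => g z / z ^ S (S m)) a ->
  clim near0' (fun z => 1 + RtoC (INR (S m)) / a * (g z / phi z ^ S m)) 1.
Proof.
  intros Hphi Hg. destruct (tangent_id_facts phi Hphi) as [_ [_ [Hp1 Hpn]]].
  (* The factor 0 is the limit of the one power of [z] by which the order of [g] exceeds that of
     [phi z ^ S m]. *)
  apply clim_eq with (1 + RtoC (INR (S m)) / a * (a * 0 / 1 ^ S m)).
  - apply clim_plus; [apply clim_const|]. apply clim_mult; [apply clim_const|].
    apply clim_ext with (fun z => g z / z ^ S (S m) * z / (phi z / z) ^ S m).
    + generalize (filter_and _ _ Hpn punctured_neq0). apply filter_imp. intros z [H1 H2].
      rewrite (Cpow_S z (S m)). unfold Cdiv at 3. rewrite Cpow_mult_l, Cpow_inv by auto.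
      field. repeat split; auto using Cpow_nz.
    + apply clim_div.
      * rewrite Cpow_1_l. apply C1_nz.
      * apply clim_mult; auto. apply clim_punctured_id.
      * now apply clim_pow.
  - rewrite Cpow_1_l, Cmult_0_r. unfold Cdiv. ring.
Qed.

Lemma form_ge2_solution (m : nat) (a : C) (f g phi psi : C -> C) :
  a <> 0 -> parabolic f -> tangent_id phi -> germ_inverse phi psi ->
  clim near0' (fun z => g z / z ^ S (S m)) a -> g 0 = 0 ->
  near0' (fun z => f z = psi (phi z *
    Croot (S m) (1 + RtoC (INR (S m)) / a * (g z / phi z ^ S m)))) ->
  analytic0 (fun z => a / RtoC (INR (S m)) * phi z ^ S m) /\
  near0 (fun z => a / RtoC (INR (S m)) * phi (f z) ^ S m - a / RtoC (INR (S m)) * phi z ^ S m = g z).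
Proof.
  intros Ha Hf Hphi [_ [_ [_ Hpsi]]] Hg Hg0 Hform.
  destruct (tangent_id_facts phi Hphi) as [Hhol [Hp0 [_ Hpn]]].
  assert (Hn := INR_S_neq0 m).
  assert (Harg := root_argument_clim m a g phi Hphi Hg).
  split.
  - apply hol_analytic0, hol_mult; [apply hol_const|]. now apply hol_pow.
  (* Off 0 the root is removed by raising to the power [S m]. At 0 the equation reduces to
     [g 0 = 0], thanks to [f 0 = 0]. *)
  - apply near0_center.
    + assert (Hroot : clim near0'
        (fun z => Croot (S m) (1 + RtoC (INR (S m)) / a * (g z / phi z ^ S m))) 1).
      { apply clim_eq with (Croot (S m) 1); [|apply Croot_1]. apply clim_comp; auto.
        apply hol_cont, hol_Croot. simpl. lra. }
      assert (Hin : clim near0' (fun z => phi z *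
        Croot (S m) (1 + RtoC (INR (S m)) / a * (g z / phi z ^ S m))) 0).
      { apply clim_eq with (0 * 1); [|ring]. now apply clim_mult. }
      generalize (filter_and _ _ (filter_and _ _ Hform (clim_nbhd _ 0 _ Hin Hpsi))
        (filter_and _ _ Hpn (clim_neq0 _ _ C1_nz Harg))).
      apply filter_imp. intros z [[H1 H2] [H3 H4]].
      rewrite H1, H2, Cpow_mult_l, Croot_pow by auto. field.
      repeat split; auto using Cpow_nz.
    + rewrite Hg0. destruct Hf as [-> _]. ring.
Qed.

Lemma solution_form_ge2 (m : nat) (a : C) (f g H : C -> C) :
  a <> 0 -> parabolic f -> clim near0' (fun z => g z / z ^ S (S m)) a ->
  analytic0 H -> near0 (fun z => H (f z) - H z = g z) ->
  exists phi, tangent_id phi /\ exists psi, germ_inverse phi psi /\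
  near0' (fun z => f z = psi (phi z *
    Croot (S m) (1 + RtoC (INR (S m)) / a * (g z / phi z ^ S m)))).
Proof.
  intros Ha Hf Hg HH Heq. destruct (parabolic_facts f Hf) as [Hf0 [_ Hfn]].
  destruct (analytic0_cases H HH) as [Hc|[m' [E [HE [HE0 HHE]]]]].
  (* A constant [H] would make [g] vanish near 0, against its nonzero leading coefficient. *)
  { exfalso. apply Ha. apply (clim_unique (F := near0') _ _ _ _ Hg).
    apply clim_ext with (fun _ => 0); [|apply clim_const].
    generalize (filter_and _ _ (near0_punctured _ Heq)
      (filter_and _ _ (clim_nbhd f 0 _ Hf0 Hc) (near0_punctured _ Hc))).
    apply filter_imp. intros z [<- [H1 H2]]. rewrite H1, H2. unfold Cdiv. ring. }
  assert (Hlead : clim near0' (fun z => g z / z ^ S (S m')) (RtoC (INR (S m')) * E 0)).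
  { eapply clim_ext; [|exact (abel_difference_leading f H E m' (H 0) Hf HE HHE)].
    generalize (near0_punctured _ Heq). apply filter_imp. now intros z ->. }
  destruct (leading_order_unique g _ _ _ _ (Cmult_neq_0 _ _ (INR_S_neq0 m') HE0) Ha Hlead Hg)
    as [Em Ea].
  injection Em as ->. assert (Hn := INR_S_neq0 m).
  apply analytic0_hol in HE.
  (* Dividing by [E 0], which is [a] over [S m] by [Ea], gives [u 0 = 1]; the main root of [u] is
     then analytic and z times it is tangent to the identity. *)
  set (u := fun z => E z / E 0).
  assert (Hu : hol 0 u) by (apply hol_div; auto; apply hol_const).
  assert (Hu0 : u 0 = 1) by (unfold u; field; auto).
  set (phi := fun z => z * Croot (S m) (u z)).
  assert (Hphi : tangent_id phi).
  { apply tangent_id_iff. exists (fun z => Croot (S m) (u z)). split; [|split].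
    - apply hol_analytic0, (hol_comp 0 (Croot (S m)) u); auto.
      rewrite Hu0. apply hol_Croot. simpl. lra.
    - rewrite Hu0. apply Croot_1.
    - apply filter_forall. reflexivity. }
  assert (HHphi : near0 (fun z => H z = H 0 + a / RtoC (INR (S m)) * phi z ^ S m)).
  { assert (Hun : near0 (fun z => u z <> 0)).
    { apply (clim_neq0 u 1 C1_nz). rewrite <- Hu0. now apply hol_cont. }
    generalize (filter_and _ _ HHE Hun). apply filter_imp. intros z [-> Hz].
    unfold phi. rewrite Cpow_mult_l, Croot_pow by auto. unfold u. rewrite <- Ea.
    field. auto. }
  exists phi. split; auto. destruct (tangent_id_inverse phi Hphi) as [psi Hpsi].
  exists psi. split; auto. destruct (tangent_id_facts phi Hphi) as [_ [_ [_ Hpn]]].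
  destruct Hpsi as [_ [_ [Hpsi _]]]. destruct (comp_ratio_1 f phi Hf Hphi) as [_ Hr].
  generalize (filter_and _ _ (filter_and _ _ (near0_punctured _ Heq) Hpn)
    (filter_and _ _ (filter_and _ _ (clim_nbhd f 0 _ Hf0 HHphi) (near0_punctured _ HHphi))
      (filter_and _ _ (clim_nbhd f 0 _ Hf0 Hpsi) (clim_nbhd _ 1 _ Hr (pow_Croot m))))).
  apply filter_imp. intros z [[H1 H2] [[H3 H4] [H5 H6]]].
  rewrite H3, H4 in H1.
  (* The Abel equation identifies the radicand with the power [S m] of phi(f) / phi. That ratio
     tends to 1, so the main root returns it. *)
  replace (1 + RtoC (INR (S m)) / a * (g z / phi z ^ S m)) with ((phi (f z) / phi z) ^ S m).
  - rewrite H6. replace (phi z * (phi (f z) / phi z)) with (phi (f z)) by (field; auto).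
    now symmetry.
  - rewrite <- H1. unfold Cdiv at 1. rewrite Cpow_mult_l, Cpow_inv by auto.
    field. repeat split; auto using Cpow_nz.
Qed.

(** * All k together: existence, additive constants, uniqueness *)

Lemma solution_form (f g : C -> C) (k : nat) (alpha : nat -> C) (H : C -> C) :
  parabolic f -> alpha k <> 0 -> clim near0' (fun z => g z / z ^ k) (alpha k) ->
  (k = 1%nat -> alpha 0%nat = 0) ->
  globally_analytic_solution f g k alpha H ->
  exists phi, tangent_id phi /\ has_form f g k alpha phi.
Proof.
  intros Hf Ha Hg Ha0 Hsol. destruct k as [|[|m]].
  - destruct Hsol as [R [HR [_ Heq]]].
    destruct (h_defect_solve_pole (alpha 0%nat) (alpha 1%nat) R Ha HR) as [phi [Hphi Hd]].
    exists phi. split; auto. apply (defect_form_le1 _ _ 0 f g phi R); auto.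
    generalize Hd. apply filter_imp. intros z ->. ring.
  - destruct Hsol as [R [HR [_ Heq]]]. cbv zeta in Heq.
    destruct (h_defect_solve_log (alpha 1%nat) R Ha HR) as [phi [Hphi Hd]].
    exists phi. split; auto. apply (defect_form_le1 _ _ (R 0) f g phi R); auto.
    rewrite (Ha0 eq_refl). exact Hd.
  - destruct Hsol as [HH Heq]. exact (solution_form_ge2 m _ f g H Ha Hf Hg HH Heq).
Qed.

Lemma form_solution (f g : C -> C) (k : nat) (alpha : nat -> C) (phi : C -> C) :
  parabolic f -> alpha k <> 0 -> clim near0' (fun z => g z / z ^ k) (alpha k) ->
  ((1 < k)%nat -> g 0 = 0) ->
  tangent_id phi -> has_form f g k alpha phi ->
  globally_analytic_solution f g k alpha (solution_of k alpha phi).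
Proof.
  intros Hf Ha Hg Hg0 Hphi [psi [Hpsi Hform]]. destruct k as [|[|m]].
  - destruct Hform as [w [Hw Hfw]]. exact (form_le1_solution _ _ f g phi psi w Hf Hphi Hpsi Hw Hfw).
  - destruct Hform as [w [Hw Hfw]]. exact (form_le1_solution _ _ f g phi psi w Hf Hphi Hpsi Hw Hfw).
  - apply (form_ge2_solution m (alpha (S (S m))) f g phi psi); auto. apply Hg0. lia.
Qed.

Lemma solution_add_const (f g : C -> C) (k : nat) (alpha : nat -> C) (H : C -> C) (c : C) :
  globally_analytic_solution f g k alpha H ->
  globally_analytic_solution f g k alpha (fun z => H z + c).
Proof.
  assert (Hadd : forall R, analytic0 R -> analytic0 (fun z => R z + c)).
  { intros R HR. apply hol_analytic0, hol_plus; [now apply analytic0_hol|apply hol_const]. }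
  destruct k as [|[|m]].
  1,2: intros [R [HR [H1 H2]]]; exists (fun z => R z + c); split; [auto|split];
    [generalize H1; apply filter_imp; intros z ->; ring
    |generalize H2; apply filter_imp; intros z <-; ring].
  intros [HH H2]. split; auto. generalize H2. apply filter_imp. intros z <-. ring.
Qed.

(** For k <= 1 both solutions have the same singular part [h], so only the regular parts are
    compared; the constant is read off at 0. *)
Lemma solution_unique (f g : C -> C) (k : nat) (alpha : nat -> C) (H1 H2 : C -> C) :
  parabolic f ->
  globally_analytic_solution f g k alpha H1 -> globally_analytic_solution f g k alpha H2 ->
  exists c : C, same_solution k H2 (fun z => H1 z + c).
Proof.
  intros Hf.
  assert (Hdiff : forall R1 R2, analytic0 R1 -> analytic0 R2 ->
    near0' (fun z => R1 (f z) - R1 z = R2 (f z) - R2 z) ->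
    near0 (fun z => R2 z = R1 z + (R2 0 - R1 0))).
  { intros R1 R2 A1 A2 E.
    assert (Hc : near0 (fun z => R2 z - R1 z = R2 0 - R1 0)).
    { apply (invariant_constant f (fun z => R2 z - R1 z)); auto.
      - apply hol_analytic0, hol_minus; now apply analytic0_hol.
      - generalize E. apply filter_imp. intros z Hz.
        replace (R2 (f z) - R1 (f z) - (R2 z - R1 z))
          with (R2 (f z) - R2 z - (R1 (f z) - R1 z)) by ring.
        rewrite Hz. ring. }
    generalize Hc. apply filter_imp. intros z <-. ring. }
  destruct k as [|[|m]].
  1,2: intros [R1 [A1 [E1 K1]]] [R2 [A2 [E2 K2]]]; exists (R2 0 - R1 0);
    assert (Hc : near0 (fun z => R2 z = R1 z + (R2 0 - R1 0))) by
      (apply Hdiff; auto; generalize (filter_and _ _ K1 K2); apply filter_imp;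
       intros z [-> ->]; reflexivity);
    generalize (filter_and _ _ (near0_punctured _ Hc) (filter_and _ _ E1 E2));
    unfold same_solution; apply filter_imp; intros z [-> [-> ->]]; ring.
  intros [A1 K1] [A2 K2]. exists (H2 0 - H1 0). apply Hdiff; auto.
  generalize (near0_punctured _ (filter_and _ _ K1 K2)). apply filter_imp.
  intros z [-> ->]. reflexivity.
Qed.

Theorem theorem4p5 (f g : C -> C) (k : nat) (alpha : nat -> C)
  (f_prenormalized : prenormalized f)
  (g_analytic : analytic0 g)
  (g_nonzero : ~ near0 (fun z => g z = 0))
  (alpha_k_neq0 : alpha k <> 0)
  (g_multiplicity : o_pow k (fun z => g z - alpha k * z ^ k))
  (g_order1 : (k <= 1)%nat ->
     o_pow 1 (fun z => g z - (alpha 0%nat + alpha 1%nat * z))) :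
  ((exists H, globally_analytic_solution f g k alpha H) <->
   (exists phi, tangent_id phi /\ has_form f g k alpha phi)) /\
  (forall phi, tangent_id phi -> has_form f g k alpha phi ->
     globally_analytic_solution f g k alpha (solution_of k alpha phi)) /\
  (forall H (c : C), globally_analytic_solution f g k alpha H ->
     globally_analytic_solution f g k alpha (fun z => H z + c)) /\
  (forall H1 H2, globally_analytic_solution f g k alpha H1 ->
     globally_analytic_solution f g k alpha H2 ->
     exists c : C, same_solution k H2 (fun z => H1 z + c)).
Proof.
  assert (Hf := prenormalized_parabolic f f_prenormalized).
  assert (Hg := o_pow_leading k g (alpha k) g_multiplicity).
  assert (Hg0 : (0 < k)%nat -> g 0 = 0).
  { intros Hk. destruct k as [|k]; [lia|].
    generalize (o_pow_at0 _ _ g_multiplicity). cbv beta. rewrite Cpow_S. intros E.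
    replace (g 0) with (g 0 - alpha (S k) * (0 * 0 ^ k)) by ring. exact E. }
  (* Both expansions of [g] are evaluated at 0: multiplicity 1 gives [g 0 = 0], and the expansion to
     order 1 gives [g 0 = alpha 0]. *)
  assert (Ha0 : k = 1%nat -> alpha 0%nat = 0).
  { intros ->. assert (E := o_pow_at0 _ _ (g_order1 (le_n 1))). cbv beta in E.
    rewrite Hg0 in E by lia.
    replace (alpha 0%nat) with (- (0 - (alpha 0%nat + alpha 1%nat * 0))) by ring.
    rewrite E. ring. }
  assert (Hsol : forall phi, tangent_id phi -> has_form f g k alpha phi ->
    globally_analytic_solution f g k alpha (solution_of k alpha phi)).
  { intros phi. apply form_solution; auto. intros Hk. apply Hg0. lia. }
  split; [split|split; [|split]].
  - intros [H HH]. now apply (solution_form f g k alpha H).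
  - intros [phi [Hphi Hform]]. eexists. now apply (Hsol phi).
  - exact Hsol.
  - intros H c. apply solution_add_const.
  - intros H1 H2. now apply solution_unique.
Qed.
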